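(* Let $n\ge 2$, let $X_1,\ldots,X_n$ be independent random variables distributed according to an absolutely continuous distribution function $F$ on $\mathbb{R}$ with hazard rate $h$, and let $X_{(1)}\ge X_{(2)}\ge\ldots\ge X_{(n)}$ be the order statistics. For $1\le k\le n-1$ let $\Delta_k=X_{(k)}-X_{(k+1)}$ be the $k$-th spacing, and for integers $1\le k\le n/2$ let $V_k=k\Delta_k^2$. Assume that $h$ is non-decreasing. Then: (1) For every integer $k$ with $1\le k\le n/2$ such that $X_{(k)}$ is square-integrable, $$\operatorname{Var}[X_{(k)}]\le \mathbb{E}[V_k]\le \frac{2}{k}\,\mathbb{E}\left[\left(\frac{1}{h(X_{(k+1)})}\right)^2\right].$$ (2) For every integer $k$ with $n/2<k\le n$ such that $X_{(k)}$ is square-integrable, $$\operatorname{Var}[X_{(k)}]\le \frac{2(n-k+1)}{(k-1)^2}\,\mathbb{E}\left[\left(\frac{1}{h(X_{(k)})}\right)^2\right].$$ (3) For every $\lambda\ge 0$ and every integer $k$ with $1\le k\le n/2$ such that $X_{(k)}$ is integrable, $$\log\mathbb{E}\left[e^{\lambda(X_{(k)}-\mathbb{E}X_{(k)})}\right]\le \lambda\,\frac{k}{2}\,\mathbb{E}\left[\Delta_k\left(e^{\lambda\Delta_k}-1\right)\right]=\lambda\,\frac{k}{2}\,\mathbb{E}\left[\sqrt{\frac{V_k}{k}}\left(e^{\lambda\sqrt{V_k/k}}-1\right)\right].$$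
   Context: The order statistics $X_{(1)}\ge\ldots\ge X_{(n)}$ are the non-increasing rearrangement of $X_1,\ldots,X_n$. The hazard rate of an absolutely continuous distribution function $F$ with density $f$ is $h=f/\overline{F}$, where $\overline{F}=1-F$, defined where $\overline F>0$; since $f$ is defined up to null sets, ''$h$ is non-decreasing'' means that this holds for some version of the density, and that version is used in the bounds. The right-hand sides of the inequalities are allowed to be $+\infty$. *)

(* Defs.v *)
From HB Require Import structures.
From mathcomp Require Export all_boot all_order all_algebra.
From mathcomp Require Export all_classical all_reals all_analysis.

Set Implicit Arguments.
Unset Strict Implicit.
Unset Printing Implicit Defensive.

Export Order.TTheory GRing.Theory Num.Theory.
Export numFieldNormedType.Exports.

Local Open Scope classical_set_scope.
Local Open Scope ring_scope.

Definition mutually_independent (I : finType) (d : measure_display)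
    (T : measurableType d) (R : realType) (P : probability T R)
    (X : I -> {RV P >-> R}) : Prop :=
  forall (J : {set I}) (A : I -> set R), (forall i, measurable (A i)) ->
    P (\bigcap_(i in [set` J]) (X i @^-1` A i)) =
    (\prod_(i in J) P (X i @^-1` A i))%E.

(* A specific (everywhere defined) version f of the density of F. *)
Definition is_density_of (R : realType) (f F : R -> R) : Prop :=
  [/\ measurable_fun [set: R] f,
      forall x, 0 <= f x
    & forall x, (F x)%:E = (\int[lebesgue_measure]_(t in `]-oo, x]) (f t)%:E)%E].

(* Meaningful only where F x < 1. *)
Definition hazard_rate (R : realType) (F f : R -> R) (x : R) : R :=
  f x / (1 - F x).

Definition nondecreasing_hazard_rate (R : realType) (F f : R -> R) : Prop :=
  forall x y, F x < 1 -> F y < 1 -> x <= y ->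
    hazard_rate F f x <= hazard_rate F f y.

(* (1 / h x)^2, with the inverse taken in \bar R so that 1 / 0 = +oo. *)
Definition inv_hazard_sq (R : realType) (F f : R -> R) (x : R) : \bar R :=
  ((hazard_rate F f x)%:E^-1 ^+ 2)%E.

Section order_statistics.
Context {T : Type} {R : realType} {n : nat}.
Variable X : 'I_n -> T -> R.

(* X_(k) for 1 <= k <= n, in non-increasing order: X_(1) is the maximum. *)
Definition order_stat (k : nat) (w : T) : R :=
  nth 0 (sort (fun x y : R => y <= x) [seq X i w | i <- enum 'I_n]) k.-1.

Definition spacing (k : nat) (w : T) : R :=
  order_stat k w - order_stat k.+1 w.

Definition Vstat (k : nat) (w : T) : R := k%:R * spacing k w ^+ 2.

End order_statistics.

(* Main.v *)
(* The variance and entropy of a function of independent variables tensorize: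
   replacing the variables one at a time by independent copies and using the
   joint convexity of the Bregman divergence, the Phi-entropy of [W] is at most
   the sum of the expected divergences between [W] and functions [W_i] that do
   not depend on the i-th variable. For an order statistic, taking the order
   statistic of the sample deprived of its i-th element bounds that sum by [k]
   times the divergence between consecutive order statistics.

   Conditionally on [X_(k+1) = x], the k-th spacing exceeds [t] with probability
   [(S (x + t) / S x) ^ k], where [S = 1 - F]. When the hazard rate [h] is
   non-decreasing, [- ln S] is convex with subgradient [h], so this probability
   is at most [exp (- k h(x) t)], which gives the second moment bounds, and is
   non-increasing in [x], so that an increasing function of [X_(k+1)] and an
   increasing function of the spacing are negatively correlated. The latter
   bounds [Ent (exp (l X_(k)))] by [E (exp (l X_(k)))] times a moment of the
   spacing, and Herbst's argument integrates this differential inequality.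

   All of this is done for order statistics clipped to [[-m, m]]; the limit in
   [m] is taken by Fatou's lemma. *)
From HB Require Import structures.
From mathcomp Require Import ring lra zify measurable_realfun.
Require Import Defs.

Set Implicit Arguments.
Unset Strict Implicit.
Unset Printing Implicit Defensive.

Local Open Scope ring_scope.

(** * Combinatorics of order statistics *)

(** The factor [1/2] in the exponential bound is out of reach of the scaling
    [psi (t * x) <= t ^+ 2 * psi x], because [psi x] exceeds [x * (expR x - 1) / 2] for large [x].
    Scaling only the quadratic part by [t ^+ 2] and the remainder by [t ^+ 3] leaves
    [x ^+ 2 / 2 + (psi x - x ^+ 2 / 2) / 2] after integration in [t], and this is small enough
    precisely because [1 + x + x ^+ 2 / 2 <= expR x]. A bound polynomial in [t] also reduces
    everything to two fixed moments of the spacing. The density may be discontinuous, so [ln S] is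
    never differentiated, and neither is the Laplace transform: both are controlled through
    increments whose error is quadratic in the step. No conditional distribution is constructed. The
    event that the spacing exceeds [t] is split according to the index carrying X_(k+1) and the set
    of indices above it. The cell for [t] differs from the cell for [0] only by [S (x + t) ^+ k] in
    place of [S x ^+ k], so the ratio of survival functions appears by comparing the two sums. *)

Section sub_order_statistics.
Context {R : realType} {n : nat}.
Implicit Types (A S : {set 'I_n}) (z : 'I_n -> R) (k : nat) (t : R).

(** Ranks are taken within a subset of indices so that [[set~ i]] yields a statistic insensitive to
    coordinate [i]. The default [0] is never read when [0 < k <= #|A|]. *)
Definition sub_order_stat A k z : R :=
  nth 0 (sort (fun x y : R => y <= x) [seq z i | i <- enum A]) k.-1.

Local Notation full := (finset.setTfor 'I_n : {set 'I_n}).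

(** In a non-increasing list an up-closed predicate holds exactly on a prefix, whose length is its
    count. All later statements on ranks reduce to counting through this. *)
Lemma sub_order_stat_upclosed A k z (a : pred R) :
  (forall x y, a x -> x <= y -> a y) -> (0 < k <= #|A|)%N ->
  a (sub_order_stat A k z) = (k <= #|[set i in A | a (z i)]|)%N.
Proof.
move=> aup /andP[k0 kA].
rewrite /sub_order_stat; set s := sort _ _.
have -> : #|[set i in A | a (z i)]| = count a s.
  rewrite (permP (permEl (perm_sort _ _))) count_map -size_filter cardE.
  congr size; rewrite /enum_mem -filter_predI.
  by apply: eq_filter => i; rewrite /= !inE andbC.
have ss : sorted (fun x y : R => y <= x) s.
  by apply: sort_sorted => x y; exact: le_total.
have sz : (k.-1 < size s)%N by rewrite size_sort size_map -cardE prednK.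
rewrite -[in RHS](prednK k0).
elim: s k.-1 ss sz => [//|x s IH] m ss sz; rewrite [count _ _]/=.
case ax : (a x).
  rewrite add1n.
  by case: m sz => [|m] sz /=; [rewrite ax|rewrite (IH _ (path_sorted ss) sz) ltnS].
have c0 : count a s = 0%N.
  apply/eqP; rewrite -leqn0 leqNgt -has_count; apply/hasP => -[y ys ay].
  move: ss; rewrite /= path_sortedE; last by move=> ? ? ? /[swap]; exact: le_trans.
  by move=> /andP[/allP/(_ _ ys) yx _]; rewrite (aup _ _ ay yx) in ax.
rewrite c0; case: m sz => [|m] sz; first by rewrite /= ax.
by rewrite /= (IH _ (path_sorted ss) sz) c0.
Qed.

Lemma lt_sub_order_stat A k z t : (0 < k <= #|A|)%N ->
  (t < sub_order_stat A k z) = (k <= #|[set i in A | (t < z i)%R]|)%N.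
Proof.
by apply: (@sub_order_stat_upclosed A k z (fun y => t < y)) => x y;
  exact: lt_le_trans.
Qed.

Lemma le_sub_order_stat A k z t : (0 < k <= #|A|)%N ->
  (t <= sub_order_stat A k z) = (k <= #|[set i in A | (t <= z i)%R]|)%N.
Proof.
by apply: (@sub_order_stat_upclosed A k z (fun y => t <= y)) => x y;
  exact: le_trans.
Qed.

Lemma sub_order_stat_mem A k z : (0 < k <= #|A|)%N ->
  exists2 i, i \in A & sub_order_stat A k z = z i.
Proof.
move=> /andP[k0 kA].
have : sub_order_stat A k z \in [seq z i | i <- enum A].
  rewrite -(mem_sort (fun x y : R => y <= x)) mem_nth//.
  by rewrite size_sort size_map -cardE prednK.
by move=> /mapP[i]; rewrite mem_enum => iA ->; exists i.
Qed.

Lemma order_stat_sub (T : Type) (X : 'I_n -> T -> R) k w :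
  order_stat X k w = sub_order_stat full k (X ^~ w).
Proof. by rewrite /order_stat /sub_order_stat enum_setT -enumT. Qed.

Section leave_one_out.
Variables (k : nat) (z : 'I_n -> R).
Hypotheses (k_gt0 : (0 < k)%N) (k_lt_n : (k < n)%N).

Let ck : (0 < k <= #|full|)%N.
Proof. by rewrite k_gt0 cardsT card_ord ltnW. Qed.
Let ckS : (0 < k.+1 <= #|full|)%N.
Proof. by rewrite cardsT card_ord. Qed.
Let cki (i : 'I_n) : (0 < k <= #|[set~ i]|)%N.
Proof. by rewrite k_gt0 cardsC1 card_ord; lia. Qed.

Let Z := sub_order_stat full k z.
Let Y := sub_order_stat full k.+1 z.
Let Z_ (i : 'I_n) := sub_order_stat [set~ i] k z.

Let card_loo i (a : pred R) :
  (#|[set j in [set~ i] | a (z j)]| + a (z i) = #|[set j in full | a (z j)]|)%N.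
Proof.
rewrite (cardsD1 i [set j in full | a (z j)]) addnC !inE; congr (_ + _)%N.
by apply: eq_card => j; rewrite !inE.
Qed.

(** Deleting one index lowers a count by at most one. Counting at the threshold [Z_ i] itself,
    [Z_ i < Y] would give [Z_ i < Z_ i]; the next two proofs use the same self-comparison. *)
Lemma le_loo i : Y <= Z_ i.
Proof.
rewrite leNgt; apply/negP; rewrite lt_sub_order_stat// -(card_loo i) => h.
suff : Z_ i < Z_ i by rewrite ltxx.
rewrite {2}/Z_ lt_sub_order_stat// -/(Z_ i) -ltnS; apply: leq_trans h _;
  by rewrite -addn1 leq_add2l leq_b1.
Qed.

Lemma loo_le i : Z_ i <= Z.
Proof.
rewrite leNgt; apply/negP; rewrite lt_sub_order_stat// => h.
suff : Z < Z by rewrite ltxx.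
by rewrite {2}/Z lt_sub_order_stat// -/Z -(card_loo i);
  apply: leq_trans h (leq_addr _ _).
Qed.

Lemma loo_low i : z i <= Y -> Z_ i = Z.
Proof.
move=> ziY; apply/eqP; rewrite eq_le loo_le/= leNgt; apply/negP.
rewrite lt_sub_order_stat// -(card_loo i).
rewrite [Z_ i < z i]ltNge (le_trans ziY (le_loo i)) addn0 => h.
suff : Z_ i < Z_ i by rewrite ltxx.
by rewrite {2}/Z_ lt_sub_order_stat.
Qed.

Lemma loo_high i : Z <= z i -> Z_ i = Y.
Proof.
move=> Zzi; apply/eqP; rewrite eq_le le_loo andbT.
rewrite le_sub_order_stat// -(card_loo i) (le_trans (loo_le i) Zzi) addn1 ltnS.
by rewrite -le_sub_order_stat.
Qed.

(** Origin of the factor [k]: by [loo_low], deleting any other index leaves the k-th order statistic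
    unchanged. *)
Lemma card_above : (#|[set i | (Y < z i)%R]| <= k)%N.
Proof.
have := ltxx Y; rewrite {2}/Y lt_sub_order_stat// => /negbT.
rewrite -leqNgt; apply: leq_trans; apply: subset_leq_card.
by apply/fintype.subsetP => i; rewrite !inE.
Qed.

(** Origin of the factor [n - k]: by [loo_high], deleting any other index gives exactly [Y], so such
    an index contributes nothing when [Y] is the statistic under study. *)
Lemma card_below : (#|[set i | (z i < Z)%R]| <= n - k)%N.
Proof.
have := lexx Z; rewrite {2}/Z le_sub_order_stat//.
have : (#|[set i | (z i < Z)%R]| + #|[set i in full | (Z <= z i)%R]| = n)%N.
  rewrite -[RHS]card_ord -(cardsC [set i | (z i < Z)%R]); congr (_ + _)%N.
  by apply: eq_card => i; rewrite !inE -leNgt.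
by lia.
Qed.

Lemma le_consecutive : Y <= Z.
Proof.
have i : 'I_n by exists 0%N; exact: leq_ltn_trans k_lt_n.
exact: le_trans (le_loo i) (loo_le i).
Qed.

(* [j] is the index of the (k+1)-st largest value and [S] the set of indices
   of the [k] larger ones, each of which is larger by more than [t]. *)
Definition gap_config t (p : 'I_n * {set 'I_n}) : bool :=
  [forall i in p.2, z p.1 + t < z i] &&
  [forall i in ~: (p.1 |: p.2), z i <= z p.1].

Lemma gap_configP t (p : 'I_n * {set 'I_n}) : 0 <= t -> #|p.2| = k ->
  p.1 \notin p.2 ->
  gap_config t p -> [/\ z p.1 = Y, t < Z - Y & p.2 = [set i | Y < z i]].
Proof.
case: p => j S /= t0 cS jS /andP[/forall_inP/= hS /forall_inP/= hC].
have SE : S = [set i | z j < z i].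
  apply/setP => i; rewrite inE; apply/idP/idP => [iS|].
    by apply: le_lt_trans (hS _ iS); rewrite lerDl.
  apply: contraLR => iS; rewrite -leNgt.
  have [->//|ij] := eqVneq i j.
  by apply: hC; rewrite !inE negb_or ij.
have zY : z j = Y.
  apply/eqP; rewrite eq_le; apply/andP; split.
    rewrite le_sub_order_stat// -cS -add1n.
    have -> : (1 + #|S| = #|j |: S|)%N by rewrite cardsU1 jS.
    apply: subset_leq_card; apply/fintype.subsetP => i;
      rewrite !inE => /orP[/eqP->|]; first exact: lexx.
    by rewrite SE inE => /ltW ->.
  rewrite leNgt; apply/negP; rewrite lt_sub_order_stat//.
  have -> : [set i in full | z j < z i] = S by rewrite SE; apply/setP => i;
    rewrite !inE.
  by rewrite cS ltnn.
split=> //; last by rewrite -zY.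
rewrite ltrBrDl -zY lt_sub_order_stat// -[X in (X <= _)%N]cS.
by apply: subset_leq_card; apply/fintype.subsetP => i iS; rewrite !inE hS.
Qed.

(** For distinct values exactly one configuration occurs if the gap exceeds [t], and none otherwise.
    In each cell the position of the (k+1)-st value is a fixed index, which is what independence can
    act on. *)
Lemma sum_gap_config (g : R -> R) t : 0 <= t -> injective z ->
  \sum_(p : 'I_n * {set 'I_n} | (#|p.2| == k) && (p.1 \notin p.2))
    (gap_config t p)%:R * g (z p.1)
  = (t < Z - Y)%R%:R * g Y.
Proof.
move=> t0 zinj; have [tZY|ZYt] := ltP t (Z - Y); last first.
  rewrite mul0r big1// => p /andP[/eqP cp jp].
  case: (boolP (gap_config t p)) => [h|]; last by rewrite mul0r.
  by have [_ ] := gap_configP t0 cp jp h; rewrite ltNge ZYt.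
have YZ : Y < Z by rewrite -subr_gt0 (le_lt_trans t0 tZY).
have [j _ jY] := sub_order_stat_mem z ckS.
pose S : {set 'I_n} := [set i | Y < z i].
have cS : #|S| = k.
  apply/eqP; rewrite eqn_leq card_above/=.
  have -> : S = [set i in full | Y < z i] by apply/setP => i; rewrite !inE.
  by rewrite -lt_sub_order_stat// -subr_gt0 (le_lt_trans t0 tZY).
have jS : j \notin S by rewrite inE /Y jY ltxx.
rewrite (bigD1 (j, S))/=; last by rewrite cS eqxx jS.
rewrite big1 ?addr0 => [|p /andP[/andP[/eqP cp jp] pN]]; last first.
  case: (boolP (gap_config t p)) => [h|]; last by rewrite mul0r.
  have [zp _ pS] := gap_configP t0 cp jp h; case/eqP: pN.
  by case: p zp pS {cp jp h} => a b /= zp ->; congr (_, _); apply: zinj;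
    rewrite zp /Y jY.
suff -> : gap_config t (j, S) by rewrite /Y jY.
apply/andP; split; apply/forall_inP => i /=.
  rewrite inE => Yzi; rewrite -jY -/Y -ltrBrDl; apply: lt_le_trans tZY _.
  rewrite lerD2r leNgt; apply/negP => ziZ.
  (* Were [z i < Z], then [i] together with the indices of value at least [Z] would give [k + 1]
     elements of [S]. *)
  have : (k.+1 <= #|S|)%N; last by rewrite cS ltnn.
  have := lexx Z; rewrite {2}/Z le_sub_order_stat// => /leq_ltn_trans; apply.
  rewrite (cardsD1 i S) inE Yzi add1n ltnS; apply: subset_leq_card.
  apply/fintype.subsetP => l; rewrite !inE /= => Zzl; apply/andP; split;
    last exact: lt_le_trans Zzl.
  by apply: contraTneq Zzl => ->; rewrite -ltNge.
by rewrite -jY !inE negb_or -leNgt => /andP[_].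
Qed.

Lemma lt_consecutive : injective z -> Y < Z.
Proof.
move=> zinj; have [i _ iY] := sub_order_stat_mem z ckS.
rewrite lt_sub_order_stat// -ltnS.
have := lexx Y; rewrite {2}/Y le_sub_order_stat// => /leq_trans; apply.
rewrite (cardsD1 i) -add1n leq_add ?leq_b1//; apply: subset_leq_card.
apply/fintype.subsetP => j; rewrite !inE => /and3P[ji _ Yj].
rewrite lt_neqAle Yj andbT /Y iY; apply: contraNneq ji => /zinj ->.
exact: eqxx.
Qed.

End leave_one_out.
End sub_order_statistics.

Local Open Scope classical_set_scope.
Local Open Scope ring_scope.

(** * Real inequalities and survival functions *)

Section real_inequalities.
Context {R : realType}.
Implicit Types (x y t u C : R).

Lemma le0_of_le_div x C : (forall N : nat, x <= C / N.+1%:R) -> x <= 0.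
Proof.
move=> xC; rewrite leNgt; apply/negP => x0.
have := xC (Num.truncn (C / x)); rewrite ler_pdivlMr ?ltr0n// leNgt mulrC.
by rewrite -ltr_pdivrMr// truncnS_gt.
Qed.

(** Replaces the sign of a derivative for functions not known to be differentiable: over [N + 1]
    equal steps the quadratic errors add up to [C * (b - a) ^+ 2 / (N + 1)]. *)
Lemma le_of_quadratic_increment (H : R -> R) (a b C : R) : a <= b ->
  (forall s t, a <= s -> s <= t -> t <= b -> H t - H s <= C * (t - s) ^+ 2) ->
  H b <= H a.
Proof.
move=> ab HC; rewrite -subr_le0; apply: (@le0_of_le_div _ (C * (b - a) ^+ 2)) => N.
pose x i : R := a + (b - a) * (i%:R / N.+1%:R).
have N0 : N.+1%:R != 0 :> R by rewrite pnatr_eq0.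
have -> : H b - H a = \sum_(0 <= i < N.+1) (H (x i.+1) - H (x i)).
  rewrite (@telescope_sumr _ _ _ (fun i => H (x i)))//.
  by congr (H _ - H _); rewrite /x ?divff// ?mulr1 ?mul0r ?mulr0 ?addr0// subrKC.
have step i : x i.+1 - x i = (b - a) / N.+1%:R by rewrite /x -natr1; field.
apply: (@le_trans _ _ (\sum_(0 <= i < N.+1) C * ((b - a) / N.+1%:R) ^+ 2)).
  rewrite !big_nat; apply: ler_sum => i /andP[_ iN]; rewrite -(step i); apply: HC.
  - by rewrite lerDl mulr_ge0 ?subr_ge0// divr_ge0.
  - by rewrite -subr_ge0 step mulr_ge0 ?subr_ge0// invr_ge0.
  - rewrite /x -lerBrDl ler_piMr ?subr_ge0// ler_pdivrMr ?ltr0n// mul1r ler_nat.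
    exact: iN.
rewrite sumr_const_nat subn0 -mulr_natl le_eqVlt; apply/orP; left; apply/eqP.
by field.
Qed.

Lemma expR_ge_quadratic x : 0 <= x -> 1 + x + x ^+ 2 / 2 <= expR x.
Proof.
move=> x0; pose f (y : R) := expR y - (1 + y + y ^+ 2 / 2).
have df y : is_derive y 1 f (expR y - 1 - y).
  have h := is_deriveB (is_derive_expR y) (is_deriveD (is_deriveD
    (is_derive_cst (1 : R) y 1) (is_derive_id y 1))
    (is_deriveM (is_deriveX 2 (is_derive_id y 1)) (is_derive_cst (2^-1 : R) y 1))).
  by apply: (is_derive_eq h); rewrite /GRing.scale/=; field.
have cf : continuous f.
  by move=> y; apply/differentiable_continuous/derivable1_diffP; case: (df y).
have := @ger0_derive1_ndecry R f 0 _ _ _ 0 x (lexx _) x0.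
rewrite /f expR0 expr0n/= mul0r !addr0 subrr subr_ge0; apply.
- by move=> y _; case: (df y).
- move=> y _; rewrite derive1E (@derive_val _ _ _ _ _ _ _ (df y)).
  by have := expR_ge1Dx y; lra.
- exact: continuous_subspaceT.
Qed.

(** The primitive of [s * expR s] that vanishes at [0]. *)
Definition psi x : R := 1 + (x - 1) * expR x.

Lemma psi_ge0 x : 0 <= psi x.
Proof.
rewrite /psi; have := expR_ge1Dx (- x); have := expR_gt0 x.
have : expR x * expR (- x) = 1 by rewrite -expRD subrr expR0.
by nra.
Qed.

Lemma is_derive_psi x : is_derive x 1 psi (x * expR x).
Proof.
have h := is_deriveD (is_derive_cst (1 : R) x 1) (is_deriveM
  (is_deriveB (is_derive_id x 1) (is_derive_cst (1 : R) x 1)) (is_derive_expR x)).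
by apply: (is_derive_eq h); rewrite /GRing.scale/= !fctE; ring.
Qed.

Lemma is_derive_psiM u x :
  is_derive x 1 (fun y => psi (u * y)) (u * (u * x * expR (u * x))).
Proof.
have h := @is_derive1_comp _ psi (fun y => u * y) x _ _ (is_derive_psi (u * x))
  (is_deriveZ u (is_derive_id x 1)).
by apply: (is_derive_eq h); rewrite /GRing.scale/=; ring.
Qed.

Lemma continuous_psi : continuous psi.
Proof.
move=> y; apply/differentiable_continuous/derivable1_diffP.
by case: (is_derive_psi y).
Qed.

(* [x |-> (psi x - x ^+ 2 / 2) / x ^+ 3] is nondecreasing *)
Lemma psi_scale u x : 0 <= u <= 1 -> 0 <= x ->
  psi (u * x) <= u ^+ 2 * (x ^+ 2 / 2) + u ^+ 3 * (psi x - x ^+ 2 / 2).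
Proof.
move=> /andP[u0 u1] x0.
pose f (y : R) := u ^+ 2 * (y ^+ 2 / 2) + u ^+ 3 * (psi y - y ^+ 2 / 2) - psi (u *
  y).
have df y : is_derive y 1 f (u ^+ 2 * y * (u * (expR y - 1) - (expR (u * y) - 1))).
  have d2 := is_deriveM (is_deriveX 2 (is_derive_id y 1))
    (is_derive_cst (2^-1 : R) y 1).
  have h := is_deriveB (is_deriveD (is_deriveZ (u ^+ 2) d2)
    (is_deriveZ (u ^+ 3) (is_deriveB (is_derive_psi y) d2))) (is_derive_psiM u y).
  by apply: (is_derive_eq h); rewrite /GRing.scale/=; field.
have cf : continuous f.
  by move=> y; apply/differentiable_continuous/derivable1_diffP; case: (df y).
rewrite -subr_ge0 -[leRHS]/(f x).
have f0 : f 0 = 0 by rewrite /f /psi mulr0 expR0; ring.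
rewrite -f0.
apply: (@ger0_derive1_ndecry R f 0 _ _ _ 0 x (lexx _) x0).
- by move=> y _; case: (df y).
- move=> y; rewrite in_itv/= andbT => y0.
  rewrite derive1E (@derive_val _ _ _ _ _ _ _ (df y)).
  rewrite mulr_ge0// ?mulr_ge0 ?sqr_ge0 ?(ltW y0)//.
  have := @convex_expR R (Itv01 u0 u1) y 0.
  rewrite !convRE/= expR0 mulr0 addr0 /unstable.onem; lra.
- exact: continuous_subspaceT.
Qed.

Lemma psi_ge_quadratic x : 0 <= x -> x ^+ 2 / 2 <= psi x.
Proof.
move=> x0; pose f (y : R) := psi y - y ^+ 2 / 2.
have df y : is_derive y 1 f (y * (expR y - 1)).
  have d2 := is_deriveM (is_deriveX 2 (is_derive_id y 1))
    (is_derive_cst (2^-1 : R) y 1).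
  have h := is_deriveB (is_derive_psi y) d2.
  by apply: (is_derive_eq h); rewrite /GRing.scale/=; field.
have cf : continuous f.
  by move=> y; apply/differentiable_continuous/derivable1_diffP; case: (df y).
have f0 : f 0 = 0 by rewrite /f /psi expR0; ring.
rewrite -subr_ge0 -[leRHS]/(f x) -f0.
apply: (@ger0_derive1_ndecry R f 0 _ _ _ 0 x (lexx _) x0).
- by move=> y _; case: (df y).
- move=> y; rewrite in_itv/= andbT => y0.
  rewrite derive1E (@derive_val _ _ _ _ _ _ _ (df y)) mulr_ge0 ?ltW//.
  by rewrite subr_gt0 expR_gt1.
- exact: continuous_subspaceT.
Qed.

Lemma psi_ndecr x y : 0 <= x -> x <= y -> psi x <= psi y.
Proof.
move=> x0 xy; apply: (@ger0_derive1_ndecry R psi 0 _ _ _ x y) => //.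
- move=> t; rewrite in_itv/= andbT => t0.
  rewrite derive1E (@derive_val _ _ _ _ _ _ _ (is_derive_psi t)).
  by rewrite mulr_ge0 ?expR_ge0// ltW.
- exact/continuous_subspaceT/continuous_psi.
Qed.

(* [expR q * psi (p - q)] is the Bregman divergence of [a * ln a] at
   [expR p], [expR q]. *)
Lemma expR_psi_nincr q q' p : q <= q' -> q' <= p ->
  expR q' * psi (p - q') <= expR q * psi (p - q).
Proof.
move=> qq' q'p.
have E a : expR a * psi (p - a) = expR a + (p - a - 1) * expR p.
  by rewrite /psi mulrDr mulr1 mulrCA -expRD subrKC.
rewrite !E; have := expR_ge1Dx (q - q'); have e' := expR_gt0 q'.
have -> : expR q = expR q' * expR (q - q') by rewrite -expRD subrKC.
have : expR q' <= expR p by rewrite ler_expR.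
by nra.
Qed.

(** The left side is the integral over [t] in [0, 1] of the bound in [psi_scale], divided by
    [t ^+ 2]. After cancellation the claim is [expR_ge_quadratic]. *)
Lemma psi_half_le x : 0 <= x ->
  x ^+ 2 / 2 + (psi x - x ^+ 2 / 2) / 2 <= x * (expR x - 1) / 2.
Proof. by move=> /expR_ge_quadratic; rewrite /psi; lra. Qed.

(** [(1 - x) * expR x <= 1], while [(1 - x) * (1 + x + 2 * x ^+ 2) = 1 + x ^+ 2 * (1 - 2 * x)],
    which is at least [1] up to [x = 1 / 2]. *)
Lemma expR_le_quadratic x : x <= 1 / 2 -> expR x <= 1 + x + 2 * x ^+ 2.
Proof.
move=> x2; have p : 0 < 1 - x by lra.
rewrite -(ler_pM2r p); apply: (@le_trans _ _ 1); last by nra.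
have := expR_ge1Dx (- x); have := expR_gt0 x.
have : expR x * expR (- x) = 1 by rewrite -expRD subrr expR0.
by nra.
Qed.

End real_inequalities.

(* [h] is a subgradient of [- ln S]; both bounds follow by subdividing [x, y]. *)
Section survival_function.
Context {R : realType}.
Variables S h : R -> R.
Hypothesis S_ge0 : forall x, 0 <= S x.
Hypothesis S_nincr : forall x y, x <= y -> S y <= S x.
Hypothesis h_ge0 : forall x, 0 < S x -> 0 <= h x.
Hypothesis h_ndecr : forall x y, 0 < S y -> x <= y -> h x <= h y.
Hypothesis S_incr_ge : forall x y, x <= y -> 0 < S y ->
  h x * S y * (y - x) <= S x - S y.
Hypothesis S_incr_le : forall x y, x <= y -> 0 < S y ->
  S x - S y <= h y * S x * (y - x).

Let S_gt0 x y : x <= y -> 0 < S y -> 0 < S x.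
Proof. by move=> xy /lt_le_trans; apply; exact: S_nincr. Qed.

Lemma le_ln_survival x y : x <= y -> 0 < S y ->
  h x * (y - x) <= ln (S x) - ln (S y).
Proof.
move=> xy Sy0.
suff : ln (S y) + h x * y <= ln (S x) + h x * x by lra.
apply: (@le_of_quadratic_increment _ (fun t => ln (S t) + h x * t) _ _ (h y ^+ 2))
  => // s t xs st ty.
have St0 : 0 < S t := S_gt0 ty Sy0.
have Ss0 : 0 < S s := S_gt0 st St0.
have hx0 : 0 <= h x by apply: h_ge0; apply: S_gt0 Ss0.
have hxs : h x <= h s by apply: h_ndecr.
have hxy : h x <= h y by apply: h_ndecr.
have hty : h t <= h y by apply: h_ndecr.
have d0 : 0 <= t - s by rewrite subr_ge0.
(* The increment bound carries the factor [S t / S s]; replacing it by its lower bound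
   [1 - h y * (t - s)] costs only a second-order term, which gives the constant [h y ^+ 2]. *)
have le1 : S t / S s - 1 <= - (h x * (t - s)) * (1 - h y * (t - s)).
  have q : S t / S s <= 1 - h x * (t - s) * (S t / S s).
    rewrite ler_pdivrMr// mulrBl mul1r -[X in _ - X]mulrA divfK ?gt_eqF//.
    have := S_incr_ge st St0.
    have : h x * S t * (t - s) <=
      h s * S t * (t - s) by rewrite ler_wpM2r// ler_wpM2r// ltW.
    by lra.
  have q' : 1 - h y * (t - s) <= S t / S s.
    rewrite ler_pdivlMr// mulrBl mul1r.
    have := S_incr_le st St0.
    have : h t * S s * (t - s) <=
      h y * S s * (t - s) by rewrite ler_wpM2r// ler_wpM2r// ltW.
    by lra.
  have : h x * (t - s) * (1 - h y * (t - s)) <= h x * (t - s) * (S t / S s).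
    by rewrite ler_wpM2l// mulr_ge0.
  by lra.
have : ln (S t) - ln (S s) <= S t / S s - 1.
  rewrite -ln_div ?posrE//.
  have r0 : 0 < S t / S s by rewrite divr_gt0.
  have := @le_ln1Dx _ (S t / S s - 1); rewrite subrKC; apply; lra.
have : h x * h y * (t - s) ^+ 2 <= h y ^+ 2 * (t - s) ^+ 2.
  by rewrite ler_wpM2r ?sqr_ge0// expr2 ler_wpM2r// (le_trans hx0).
by lra.
Qed.

Lemma ln_survival_le x y : x <= y -> 0 < S y ->
  ln (S x) - ln (S y) <= h y * (y - x).
Proof.
move=> xy Sy0.
suff : - (ln (S y) + h y * y) <= - (ln (S x) + h y * x) by lra.
apply: (@le_of_quadratic_increment _ (fun t => - (ln (S t) + h y * t)) _ _
  (h y ^+ 2 * S x / S y)) => // s t xs st ty.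
have St0 : 0 < S t := S_gt0 ty Sy0.
have Ss0 : 0 < S s := S_gt0 st St0.
have ht0 : 0 <= h t by apply: h_ge0.
have hty : h t <= h y by apply: h_ndecr.
have d0 : 0 <= t - s by rewrite subr_ge0.
have hh : S s - S t <= h y * S s * (t - s).
  apply: le_trans (S_incr_le st St0) _.
  by rewrite ler_wpM2r// ler_wpM2r// ltW.
have le1 : S s / S t - 1 <= h y * (t - s) + h y ^+ 2 * (S s / S t) * (t - s) ^+ 2.
  have q : S s / S t - 1 <= h y * (t - s) * (S s / S t).
    rewrite lerBlDr ler_pdivrMr// mulrDl mul1r -[X in X + _]mulrA divfK ?gt_eqF//;
      lra.
  apply: (le_trans q).
  have : h y * (t - s) * (S s / S t - 1) <=
    h y * (t - s) * (h y * (t - s) * (S s / S t)).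
    by rewrite ler_wpM2l// mulr_ge0// (le_trans ht0).
  by lra.
have : ln (S s) - ln (S t) <= S s / S t - 1.
  rewrite -ln_div ?posrE//.
  have r0 : 0 < S s / S t by rewrite divr_gt0.
  have := @le_ln1Dx _ (S s / S t - 1); rewrite subrKC; apply; lra.
have : h y ^+ 2 * (S s / S t) * (t - s) ^+ 2 <= h y ^+ 2 * S x / S y * (t - s) ^+ 2.
  rewrite ler_wpM2r ?sqr_ge0// -mulrA ler_wpM2l ?sqr_ge0//.
  apply: ler_pM; rewrite ?invr_ge0 ?(ltW Ss0) ?(ltW St0) ?S_nincr//.
  by rewrite lef_pV2 ?posrE// S_nincr.
by lra.
Qed.

Lemma survival_exp_le x y : x <= y -> 0 < S x ->
  S y <= S x * expR (- (h x * (y - x))).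
Proof.
move=> xy Sx0; have := S_ge0 y; rewrite le_eqVlt => /orP[/eqP <-|Sy0].
  by rewrite mulr_ge0 ?expR_ge0// ltW.
rewrite -ler_ln ?posrE// ?mulr_gt0 ?expR_gt0// lnM ?posrE ?expR_gt0// expRK.
by have := le_ln_survival xy Sy0; lra.
Qed.

Lemma survival_log_concave x y t : x <= y -> 0 <= t ->
  S (y + t) * S x <= S (x + t) * S y.
Proof.
move=> xy t0; have := S_ge0 (y + t).
rewrite le_eqVlt => /orP[/eqP <-|Syt0]; first by rewrite mul0r mulr_ge0.
have Sy0 : 0 < S y by apply: S_gt0 Syt0; rewrite lerDl.
have Sx0 : 0 < S x by apply: S_gt0 Sy0.
have xyt : x + t <= y + t by rewrite lerD2r.
have Sxt0 : 0 < S (x + t) by apply: S_gt0 Syt0.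
rewrite -ler_ln ?posrE ?mulr_gt0// !lnM ?posrE//.
(* Slopes of [- ln S] are compared on [x, y] and [x + t, y + t] if [y <= x + t], and on [x, x + t]
   and [y, y + t] otherwise. In both cases the first interval ends before the second begins. *)
have [yxt|xty] := leP y (x + t).
  have := ln_survival_le xy Sy0; have := le_ln_survival xyt Syt0.
  have : h y * (y - x) <= h (x + t) * (y - x).
    by rewrite ler_wpM2r ?subr_ge0// h_ndecr.
  by rewrite !opprD; lra.
have a : x <= x + t by rewrite lerDl.
have b : y <= y + t by rewrite lerDl.
have := ln_survival_le a Sxt0; have := le_ln_survival b Syt0.
have : h (x + t) * t <= h y * t by rewrite ler_wpM2r// h_ndecr// ltW.
have -> : y + t - y = t by ring.
have -> : x + t - x = t by ring.
by lra.
Qed.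

End survival_function.

(** * Bounded measurable functions *)

(** A class closed under the operations needed and integrable for every probability, so that
    real-valued integrals can be computed with freely; clipping brings the order statistics into
    it. *)
Definition bounded_measurable {R : realType} {d} {T : measurableType d}
    (g : T -> R) : Prop :=
  measurable_fun [set: T] g /\ exists M, forall x, `|g x| <= M.

Section bounded_measurable_theory.
Context {R : realType} {d} {T : measurableType d}.
Implicit Types (g h : T -> R).

Lemma bounded_measurable_cst (c : R) : bounded_measurable (fun _ : T => c).
Proof. by split; [exact: measurable_cst|exists `|c|]. Qed.

Lemma bounded_measurableD g h : bounded_measurable g -> bounded_measurable h ->
  bounded_measurable (fun x => g x + h x).
Proof.
move=> [mg [M gM]] [mh [N hN]]; split; first exact: measurable_funD.
by exists (M + N) => x; rewrite (le_trans (ler_normD _ _))// lerD.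
Qed.

Lemma bounded_measurableM g h : bounded_measurable g -> bounded_measurable h ->
  bounded_measurable (fun x => g x * h x).
Proof.
move=> [mg [M gM]] [mh [N hN]]; split; first exact: measurable_funM.
by exists (M * N) => x; rewrite normrM ler_pM.
Qed.

Lemma bounded_measurableZ (c : R) g : bounded_measurable g ->
  bounded_measurable (fun x => c * g x).
Proof. by move=> bg; apply: bounded_measurableM => //;
  exact: bounded_measurable_cst. Qed.

Lemma bounded_measurableN g : bounded_measurable g ->
  bounded_measurable (fun x => - g x).
Proof.
by move=> [mg [M gM]]; split; [exact: measurableT_comp|exists M => x;
  rewrite normrN].
Qed.

Lemma bounded_measurableB g h : bounded_measurable g -> bounded_measurable h ->
  bounded_measurable (fun x => g x - h x).
Proof. by move=> bg bh; apply: bounded_measurableD => //;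
  exact: bounded_measurableN. Qed.

Lemma bounded_measurable_sum (I : Type) (r : seq I) (p : pred I) (g : I -> T -> R) :
  (forall i, bounded_measurable (g i)) ->
  bounded_measurable (fun x => \sum_(i <- r | p i) g i x).
Proof.
move=> bg; elim: r => [|i r IH].
  by under eq_fun do rewrite big_nil; exact: bounded_measurable_cst.
under eq_fun do rewrite big_cons; case: (p i) => //.
exact: bounded_measurableD.
Qed.

Lemma bounded_measurable_comp d' (T' : measurableType d') g (f : T' -> T) :
  measurable_fun [set: T'] f -> bounded_measurable g -> bounded_measurable (g \o f).
Proof.
move=> mf [mg [M gM]]; split; first exact: measurableT_comp.
by exists M => x /=.
Qed.

Lemma bounded_measurable_range (lo hi : R) g : measurable_fun [set: T] g ->
  (forall x, lo <= g x <= hi) -> bounded_measurable g.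
Proof.
move=> mg gl; split => //; exists (`|lo| + `|hi|) => x.
have /andP[a b] := gl x.
have := ler_norm (- lo); have := ler_norm hi; rewrite normrN.
have := normr_ge0 lo; have := normr_ge0 hi.
by rewrite ler_norml; lra.
Qed.

Lemma bounded_measurable_bool (b : T -> bool) : measurable_fun [set: T] b ->
  bounded_measurable (fun x => (b x)%:R : R).
Proof.
move=> mb; apply: (@bounded_measurable_range 0 1); last by move=> x; case: (b x);
  rewrite ?lexx ?ler01.
have -> : (fun x => (b x)%:R : R) = (fun x => if b x then 1 else 0).
  by apply/funext => x; case: (b x).
exact: measurable_fun_ifT.
Qed.

Variable P : probability T R.

Lemma bounded_measurable_integrable g : bounded_measurable g ->
  P.-integrable [set: T] (EFin \o g).
Proof.
move=> [mg [M gM]]; apply: (@le_integrable _ _ _ _ _ _ _ (EFin \o cst M)) => //.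
- exact/measurable_EFinP.
- by move=> x _; rewrite /= lee_fin (le_trans (gM x))// ler_norm.
- exact: finite_measure_integrable_cst.
Qed.

Lemma Rintegral_probability_cst (c : R) : \int[P]_w c = c.
Proof. by rewrite Rintegral_cst//= probability_setT mulr1. Qed.

Lemma Rintegral_sum (I : Type) (r : seq I) (p : pred I) (g : I -> T -> R) :
  (forall i, bounded_measurable (g i)) ->
  \int[P]_w (\sum_(i <- r | p i) g i w) = \sum_(i <- r | p i) \int[P]_w g i w.
Proof.
move=> bg; elim: r => [|i r IH].
  rewrite big_nil -[RHS](Rintegral_probability_cst 0).
  by apply: eq_Rintegral => w _; rewrite big_nil.
rewrite big_cons -IH; under eq_Rintegral do rewrite big_cons.
case: (p i) => //; rewrite RintegralD//.
  exact: bounded_measurable_integrable.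
by apply: bounded_measurable_integrable; exact: bounded_measurable_sum.
Qed.

Lemma le_Rintegral_bounded g h : bounded_measurable g -> bounded_measurable h ->
  (forall x, g x <= h x) -> \int[P]_w g w <= \int[P]_w h w.
Proof.
by move=> bg bh gh; apply: le_Rintegral => //; exact: bounded_measurable_integrable.
Qed.

Lemma EFin_Rintegral g : bounded_measurable g ->
  (\int[P]_w g w)%:E = (\int[P]_w (g w)%:E)%E.
Proof.
move=> /bounded_measurable_integrable ig; rewrite fineK//.
exact: integrable_fin_num.
Qed.

Lemma normr_Rintegral_le g M : bounded_measurable g -> (forall x, `|g x| <= M) ->
  `|\int[P]_w g w| <= M.
Proof.
move=> bg gM; rewrite (le_trans (le_normr_Rintegral _ _))//.
  exact: bounded_measurable_integrable.
rewrite -[leRHS]Rintegral_probability_cst; apply: le_Rintegral_bounded => //.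
- by apply: (@bounded_measurable_range 0 M); [apply: measurableT_comp => //;
  case: bg|move=> x; rewrite normr_ge0/=].
- exact: bounded_measurable_cst.
Qed.

End bounded_measurable_theory.

Lemma measurable_fun_inv {R : realType} {d} {T : measurableType d} (f : T -> R) :
  (forall x, 0 <= f x) -> measurable_fun [set: T] f ->
  measurable_fun [set: T] (fun x => (f x)^-1).
Proof.
move=> f0 mf; rewrite (_ : (fun x => _) = (@powR R ^~ (-1)) \o f); last first.
  by apply/funext => x /=; rewrite powR_inv1.
by apply: measurableT_comp => //; exact: measurable_powR.
Qed.

(** * Fubini's theorem for bounded functions *)

Section iterated_integrals.
Context {R : realType} {d1 d2} {T1 : measurableType d1} {T2 : measurableType d2}.
Variables (P1 : probability T1 R) (P2 : probability T2 R).
Variable g : T1 * T2 -> R.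
Hypothesis bg : bounded_measurable g.

Lemma bounded_measurable_Rintegral :
  bounded_measurable (fun x => \int[P2]_y g (x, y)).
Proof.
have bgx x : bounded_measurable (fun y => g (x, y)).
  by apply: (bounded_measurable_comp (f := pair x)).
case: (bg) => mg [M gM]; split; last by exists M => x; exact: normr_Rintegral_le.
(* The shift makes the integrand nonnegative, so that measurability comes from Tonelli's theorem. *)
pose h p := g p + M.
have bh x : bounded_measurable (fun y => h (x, y)).
  by apply: bounded_measurableD => //; exact: bounded_measurable_cst.
have h0 p : 0 <= h p by have := gM p; rewrite ler_norml /h; lra.
have -> : (fun x => \int[P2]_y g (x, y)) = (fun x => \int[P2]_y h (x, y) - M).
  apply/funext => x; rewrite RintegralD//; last 2 first.
  - exact: bounded_measurable_integrable.
  - exact/bounded_measurable_integrable/bounded_measurable_cst.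
  by rewrite Rintegral_probability_cst addrK.
apply: measurable_funB => //; apply/measurable_EFinP.
rewrite (_ : EFin \o _ = fun x => \int[P2]_y (h (x, y))%:E)%E; last first.
  by apply/funext => x; rewrite /= EFin_Rintegral.
apply: (@measurable_fun_fubini_tonelli_F _ _ _ _ _ P2 (EFin \o h)) => [|p].
  by apply/measurable_EFinP; exact: measurable_funD.
by rewrite lee_fin.
Qed.

Lemma Rintegral_swap :
  \int[P1]_x (\int[P2]_y g (x, y)) = \int[P2]_y (\int[P1]_x g (x, y)).
Proof.
have bgx x : bounded_measurable (fun y => g (x, y)).
  by apply: (bounded_measurable_comp (f := pair x)).
have bgy y : bounded_measurable (fun x => g (x, y)).
  by apply: (bounded_measurable_comp (f := pair^~ y)).
rewrite /Rintegral; congr fine.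
under eq_integral do rewrite EFin_Rintegral//.
under [RHS]eq_integral do rewrite EFin_Rintegral//.
apply: (@Fubini _ _ _ _ _ P1 P2 (EFin \o g)).
exact: (bounded_measurable_integrable (P1 \x P2)%E).
Qed.

Lemma Rintegral_prod : \int[(P1 \x P2)%E]_z g z = \int[P1]_x (\int[P2]_y g (x, y)).
Proof.
have bgx x : bounded_measurable (fun y => g (x, y)).
  by apply: (bounded_measurable_comp (f := pair x)).
rewrite /Rintegral; congr fine.
under [RHS]eq_integral do rewrite EFin_Rintegral//.
rewrite -(@integral12_prod_meas1 _ _ _ _ _ P1 P2 (EFin \o g))//.
exact: (bounded_measurable_integrable (P1 \x P2)%E).
Qed.

End iterated_integrals.

(** * Resampling and tensorization of Phi-entropies *)

Lemma Rintegral_eq_law {R : realType} {d1 d2 d3} {T1 : measurableType d1}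
    {T2 : measurableType d2} {T3 : measurableType d3}
    (P1 : probability T1 R) (P2 : probability T2 R)
    (f1 : T1 -> T3) (f2 : T2 -> T3) (g : T3 -> R) :
  measurable_fun [set: T1] f1 -> measurable_fun [set: T2] f2 ->
  (forall A, measurable A -> P1 (f1 @^-1` A) = P2 (f2 @^-1` A)) ->
  bounded_measurable g ->
  \int[P1]_x g (f1 x) = \int[P2]_x g (f2 x).
Proof.
move=> mf1 mf2 law bg; rewrite /Rintegral; congr fine.
pose F1 : {mfun T1 >-> T3} := HB.pack f1 (isMeasurableFun.Build _ _ _ _ f1 mf1).
pose F2 : {mfun T2 >-> T3} := HB.pack f2 (isMeasurableFun.Build _ _ _ _ f2 mf2).
have mg : measurable_fun [set: T3] (EFin \o g) by apply/measurable_EFinP; case: bg.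
have i1 : P1.-integrable [set: T1] ((EFin \o g) \o F1).
  by apply: bounded_measurable_integrable; exact: bounded_measurable_comp.
have i2 : P2.-integrable [set: T2] ((EFin \o g) \o F2).
  by apply: bounded_measurable_integrable; exact: bounded_measurable_comp.
transitivity (\int[pushforward P1 F1]_y (g y)%:E)%E.
  by rewrite integral_pushforward.
transitivity (\int[pushforward P2 F2]_y (g y)%:E)%E; last first.
  by rewrite integral_pushforward.
by apply: eq_measure_integral => A mA _; exact: law.
Qed.

(** * Coordinate updates and boxes in the space of samples *)

Section tuple_update.
Context {R : realType} {n : nat}.
Implicit Types (x : n.-tuple R) (i j : 'I_n) (t : R).

Definition upd x i t : n.-tuple R :=
  [tuple if j == i then t else tnth x j | j < n].

Lemma tnth_upd x i t j : tnth (upd x i t) j = if j == i then t else tnth x j.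
Proof. by rewrite tnth_mktuple. Qed.

Lemma upd_upd x i t s : upd (upd x i t) i s = upd x i s.
Proof. by apply: eq_from_tnth => j; rewrite !tnth_upd; case: eqP. Qed.

Lemma updC x i j t s : i != j -> upd (upd x i t) j s = upd (upd x j s) i t.
Proof.
move=> ij; apply: eq_from_tnth => l; rewrite !tnth_upd.
by case: eqP => // ->; rewrite eq_sym (negbTE ij).
Qed.

Lemma upd_invariant_cst (g : n.-tuple R -> R) :
  (forall i x t, g (upd x i t) = g x) -> forall x y, g x = g y.
Proof.
(* Hybrids between [x] and [y]: consecutive ones differ by one coordinate update. *)
move=> gi x y; pose v m := [tuple if (j < m)%N then tnth y j else tnth x j | j < n].
have <- : v n = y by apply: eq_from_tnth => j; rewrite tnth_mktuple ltn_ord.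
have {1}<- : v 0%N = x by apply: eq_from_tnth => j; rewrite tnth_mktuple.
suff : forall m, (m <= n)%N -> g (v 0%N) = g (v m) by apply.
elim=> // m IH mn; rewrite (IH (ltnW mn)) -(gi (Ordinal mn) (v m)
  (tnth y (Ordinal mn))).
congr g; apply: eq_from_tnth => j;
  rewrite tnth_upd !tnth_mktuple ltnS (leq_eqVlt j m).
by rewrite -val_eqE/=; case: eqP => //= e;
  have -> : j = Ordinal mn by apply: val_inj.
Qed.

Lemma measurable_upd d (T : measurableType d) (f : T -> n.-tuple R) (h : T -> R) i :
  measurable_fun [set: T] f -> measurable_fun [set: T] h ->
  measurable_fun [set: T] (fun w => upd (f w) i (h w)).
Proof.
move=> mf mh; apply/measurable_fun_tnthP => j.
rewrite (_ : _ \o _ = fun w => if j == i then h w else tnth (f w) j); last first.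
  by apply/funext => w /=; rewrite tnth_upd.
case: (j == i) => //.
by apply: (measurableT_comp (measurable_tnth j)).
Qed.

(** A pi-system generating the sigma-algebra of tuples; independence is exactly a product formula on
    it. *)
Definition boxes : set (set (n.-tuple R)) :=
  [set A | exists B : 'I_n -> set R, (forall i, measurable (B i)) /\
     A = \bigcap_i [set x | B i (tnth x i)]].

Lemma measurable_box (B : 'I_n -> set R) : (forall i, measurable (B i)) ->
  measurable (\bigcap_i [set x : n.-tuple R | B i (tnth x i)]).
Proof.
move=> mB; apply: fin_bigcap_measurable => // i _.
by rewrite -[X in measurable X]setTI; exact: measurable_tnth.
Qed.

Lemma tuple_measurableE : @measurable _ (n.-tuple R) = <<s boxes >>.
Proof.
apply/seteqP; split; last first.
  apply: smallest_sub; first exact: sigma_algebra_measurable.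
  by move=> A [B [mB ->]]; exact: measurable_box.
apply: smallest_sub; first exact: smallest_sigma_algebra.
rewrite -bigcup_seq => A [i _ [B mB <-]]; rewrite setTI.
apply: sub_sigma_algebra; exists (fun j => if j == i then B else setT); split.
  by move=> j; case: ifP.
apply/seteqP; split => [x Bx j _ /=|x /(_ i I)/=]; last by rewrite eqxx.
by case: eqP => // ->.
Qed.

End tuple_update.

Lemma boxes_setI_closed {R : realType} {n : nat} : setI_closed (@boxes R n).
Proof.
move=> _ _ [A [mA ->]] [B [mB ->]]; exists (fun i => A i `&` B i); split.
  by move=> i; exact: measurableI.
by apply/seteqP; split => [x [h1 h2] i _|x h]; [split; [exact: h1|exact: h2]|
  split => i _; have [] := h i I].
Qed.

Section resampling.
Context {R : realType} {d : measure_display} {T : measurableType d}.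
Context {P : probability T R} {n : nat}.
Variable X : 'I_n -> {RV P >-> R}.
Implicit Types (g : n.-tuple R -> R) (i j : 'I_n).

Definition sample (w : T) : n.-tuple R := [tuple X i w | i < n].

Lemma tnth_sample w i : tnth (sample w) i = X i w.
Proof. by rewrite tnth_mktuple. Qed.

Lemma measurable_sample : measurable_fun [set: T] sample.
Proof.
apply/measurable_fun_tnthP => i.
rewrite (_ : _ \o _ = X i) => [|]; first exact: measurable_funPT.
by apply/funext => w /=; rewrite tnth_sample.
Qed.

Lemma measurable_updX i :
  measurable_fun [set: n.-tuple R * T] (fun p => upd p.1 i (X i p.2)).
Proof. by apply: measurable_upd => //; apply: measurableT_comp. Qed.

(** Under independence this represents the conditional expectation given the coordinates other than
    [i]. It is kept as a function of the whole tuple so that it can be iterated. *)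
Definition partial_int (i : 'I_n) (g : n.-tuple R -> R) (x : n.-tuple R) : R :=
  \int[P]_w g (upd x i (X i w)).

Lemma bounded_upd g x i : bounded_measurable g ->
  bounded_measurable (fun w => g (upd x i (X i w))).
Proof.
move=> bg; apply: (bounded_measurable_comp (f := fun w => upd x i (X i w))) => //.
by apply: measurable_upd => //; exact: measurable_cst.
Qed.

Lemma bounded_sample g : bounded_measurable g ->
  bounded_measurable (fun w => g (sample w)).
Proof.
move=> bg; apply: (bounded_measurable_comp (f := sample)) => //.
exact: measurable_sample.
Qed.

Lemma bounded_partial_int i g : bounded_measurable g ->
  bounded_measurable (partial_int i g).
Proof.
move=> bg.
apply: (@bounded_measurable_Rintegral _ _ _ _ _ P (fun p => g (upd p.1 i (X i
  p.2)))).
by apply: (bounded_measurable_comp (measurable_updX i)).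
Qed.

Lemma partial_int_upd i g x t : partial_int i g (upd x i t) = partial_int i g x.
Proof. by apply: eq_Rintegral => w _; rewrite upd_upd. Qed.

Lemma partial_int_invariant i j g : (forall x t, g (upd x j t) = g x) ->
  forall x t, partial_int i g (upd x j t) = partial_int i g x.
Proof.
move=> gj x t; have [<-|ij] := eqVneq i j; first exact: partial_int_upd.
by apply: eq_Rintegral => w _; rewrite updC 1?eq_sym// gj.
Qed.

Hypothesis indepX : mutually_independent X.

(** The only entry of independence into the tensorization: the sample and the sample whose i-th
    coordinate is replaced by an independent copy have the same law, as both agree on boxes. *)
Lemma resample i g : bounded_measurable g ->
  \int[P]_w g (sample w) = \int[P]_w partial_int i g (sample w).
Proof.
move=> bg.
pose U (p : T * T) := upd (sample p.1) i (X i p.2).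
have mU : measurable_fun [set: T * T] U.
  apply: measurable_upd; first by apply: measurableT_comp => //;
    exact: measurable_sample.
  exact: measurableT_comp.
rewrite -(@Rintegral_prod _ _ _ _ _ P P (g \o U));
  last exact: bounded_measurable_comp.
apply: Rintegral_eq_law => //; first exact: measurable_sample.
move=> A mA.
pose S : {mfun T >-> n.-tuple R} :=
  HB.pack sample (isMeasurableFun.Build _ _ _ _ sample measurable_sample).
pose V : {mfun (T * T)%type >-> n.-tuple R} :=
  HB.pack U (isMeasurableFun.Build _ _ _ _ U mU).
apply: (@measure_unique _ _ _ boxes (fun=> setT) tuple_measurableE
  boxes_setI_closed _ _ (pushforward P S) (pushforward (P \x P)%E V)) => //.
- by move=> _; exists (fun=> setT); split => //; apply/esym;
  rewrite -subTset => x _ j _.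
- by rewrite bigcup_const//; exists 0%N.
- move=> _ [B [mB ->]].
  change (P (sample @^-1` (\bigcap_j [set x | B j (tnth x j)])) =
    (P \x P)%E (U @^-1` (\bigcap_j [set x | B j (tnth x j)]))).
  have -> : sample @^-1` (\bigcap_i0 [set x | B i0 (tnth x i0)]) =
      \bigcap_(j in [set` (finset.setTfor 'I_n)]) (X j @^-1` B j).
    apply/seteqP; split => w h j _ /=; last rewrite tnth_sample.
      by have := h j I; rewrite /= tnth_sample.
    by apply: h; rewrite /= finset.in_setT.
  have -> : U @^-1` (\bigcap_i0 [set x | B i0 (tnth x i0)]) =
      (\bigcap_(j in [set` [set~ i]%SET]) (X j @^-1` B j)) `*` (X i @^-1` B i).
    apply/seteqP; split => -[w w'] h /=.
      split => [j|]; last by have := h i I; rewrite /= tnth_upd eqxx.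
      rewrite /= finset.in_setC1 => ji; have := h j I.
      by rewrite /= tnth_upd (negbTE ji) tnth_sample.
    move=> j _ /=; rewrite tnth_upd; case: eqVneq => [->|ji]; first by case: h.
    by rewrite tnth_sample; apply: h.1; rewrite /= finset.in_setC1.
  rewrite product_measure1E; last 2 first.
  - apply: fin_bigcap_measurable => // j _.
    by rewrite -[X in measurable X]setTI; exact: measurable_funPT.
  - by rewrite -[X in measurable X]setTI; exact: measurable_funPT.
  rewrite (indepX _ mB) (bigD1 i) ?finset.in_setT//= muleC; congr (_ * _)%E.
  by rewrite (indepX _ mB); apply: eq_bigl => j; rewrite !finset.inE andTb.
- move=> _; change (P (sample @^-1` setT) < +oo)%E.
  by rewrite preimage_setT probability_setT ltry.
Qed.

Section bregman.
(* [D a b] is the Bregman divergence of [Phi]; its joint convexity is what makes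
   the [Phi]-entropy subadditive. *)
Variables (Phi dPhi : R -> R) (lo hi : R).
Let I : pred R := fun a => lo <= a <= hi.
Let D a b := Phi a - Phi b - dPhi b * (a - b).
Hypothesis mPhi : measurable_fun [set: R] Phi.
Hypothesis mdPhi : measurable_fun [set: R] dPhi.
Hypothesis bPhi : exists M : R, forall a, I a -> `|Phi a| <= M.
Hypothesis bdPhi : exists M : R, forall a, I a -> `|dPhi a| <= M.
Hypothesis D_ge0 : forall a b, I a -> I b -> 0 <= D a b.
(** Joint convexity in the form used by Jensen's inequality: an affine minorant touching [D] at
    [(a0, b0)]. *)
Hypothesis D_convex : forall a0 b0, I a0 -> I b0 -> exists c1 c2 c3,
  D a0 b0 = c1 * a0 + c2 * b0 + c3 /\
  forall a b, I a -> I b -> c1 * a + c2 * b + c3 <= D a b.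

Section bounded_compositions.
Context {d'} {T' : measurableType d'}.
Implicit Types V W : T' -> R.

Lemma bounded_Phi V : measurable_fun [set: T'] V -> (forall x, I (V x)) ->
  bounded_measurable (fun x => Phi (V x)).
Proof.
move=> mV IV; split; first exact: measurableT_comp.
by case: bPhi => M bM; exists M => x; exact: bM.
Qed.

Lemma bounded_in_range V : measurable_fun [set: T'] V -> (forall x, I (V x)) ->
  bounded_measurable V.
Proof. by move=> mV; exact: bounded_measurable_range. Qed.

Lemma bounded_bregman V W : measurable_fun [set: T'] V ->
  measurable_fun [set: T'] W ->
  (forall x, I (V x)) -> (forall x, I (W x)) ->
  bounded_measurable (fun x => D (V x) (W x)).
Proof.
move=> mV mW IV IW; apply: bounded_measurableB.
  by apply: bounded_measurableB; exact: bounded_Phi.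
apply: bounded_measurableM; last first.
  by apply: bounded_measurableB; exact: bounded_in_range.
split; first exact: measurableT_comp.
by case: bdPhi => M bM; exists M => x; exact: bM.
Qed.

Variable Q : probability T' R.

Lemma Rintegral_in_range V : measurable_fun [set: T'] V -> (forall x, I (V x)) ->
  I (\int[Q]_x V x).
Proof.
move=> mV IV; apply/andP; split.
  rewrite -[leLHS](Rintegral_probability_cst Q); apply: le_Rintegral_bounded.
  - exact: bounded_measurable_cst.
  - exact: bounded_in_range.
  - by move=> x; case/andP: (IV x).
rewrite -[leRHS](Rintegral_probability_cst Q); apply: le_Rintegral_bounded.
- exact: bounded_in_range.
- exact: bounded_measurable_cst.
- by move=> x; case/andP: (IV x).
Qed.

(** The expected divergence from a constant [b] exceeds the entropy by exactly [D (E V) b], where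
    [E V] is the mean of [V]. *)
Lemma Phi_entropy_le_bregman V b : measurable_fun [set: T'] V -> (forall x,
  I (V x)) ->
  I b ->
  \int[Q]_x Phi (V x) - Phi (\int[Q]_x V x) <= \int[Q]_x D (V x) b.
Proof.
move=> mV IV Ib.
have bV := bounded_in_range mV IV.
have bPV := bounded_Phi mV IV.
have := D_ge0 (Rintegral_in_range mV IV) Ib.
have -> : \int[Q]_x D (V x) b =
    \int[Q]_x Phi (V x) - Phi b - dPhi b * (\int[Q]_x V x - b).
  have bc c : bounded_measurable (fun _ : T' => c : R) by exact:
    bounded_measurable_cst.
  rewrite RintegralB//; first last.
  - by apply: bounded_measurable_integrable; apply: bounded_measurableZ;
      apply: bounded_measurableB.
  - by apply: bounded_measurable_integrable; apply: bounded_measurableB.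
  rewrite RintegralB ?RintegralZl ?RintegralB//;
    try by [apply: bounded_measurable_integrable
           |apply: bounded_measurable_integrable; apply: bounded_measurableB].
  by rewrite !Rintegral_probability_cst.
by rewrite /D; lra.
Qed.

Lemma bregman_Jensen V W : measurable_fun [set: T'] V ->
  measurable_fun [set: T'] W ->
  (forall x, I (V x)) -> (forall x, I (W x)) ->
  D (\int[Q]_x V x) (\int[Q]_x W x) <= \int[Q]_x D (V x) (W x).
Proof.
move=> mV mW IV IW.
have bV := bounded_in_range mV IV.
have bW := bounded_in_range mW IW.
have bc c : bounded_measurable (fun _ : T' => c : R) by exact:
  bounded_measurable_cst.
have [c1 [c2 [c3 [-> h]]]] :=
  D_convex (Rintegral_in_range mV IV) (Rintegral_in_range mW IW).
have b1 : bounded_measurable (fun x => c1 * V x + c2 * W x).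
  by apply: bounded_measurableD; exact: bounded_measurableZ.
have -> : c1 * \int[Q]_x V x + c2 * \int[Q]_x W x + c3 =
    \int[Q]_x (c1 * V x + c2 * W x + c3).
  rewrite RintegralD ?Rintegral_probability_cst//;
    try exact: bounded_measurable_integrable.
  rewrite RintegralD ?RintegralZl//; try exact: bounded_measurable_integrable;
  by apply: bounded_measurable_integrable; exact: bounded_measurableZ.
apply: le_Rintegral_bounded.
- exact: bounded_measurableD.
- exact: bounded_bregman.
- by move=> x; exact: h.
Qed.

End bounded_compositions.

Let partial_ints := foldl (fun g i => partial_int i g).

Let bounded_measurable_in_range g : measurable_fun [set: n.-tuple R] g ->
  (forall x, I (g x)) -> forall i,
    measurable_fun [set: n.-tuple R] (partial_int i g)
    /\ forall x, I (partial_int i g x).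
Proof.
move=> mg Ig i; have bg := bounded_in_range mg Ig; split.
  by case: (bounded_partial_int i bg).
by move=> x; apply: Rintegral_in_range => //; case: (bounded_upd x i bg).
Qed.

(** Integrating out coordinate [i] costs at most the divergence from [V i], which is constant in
    that coordinate ([H1]). The divergences still to be paid concern averaged functions, and
    averaging does not increase them ([H2]). *)
Let tensorization_seq (s : seq 'I_n) (W : n.-tuple R -> R) (V : 'I_n -> n.-tuple R
  -> R) :
  measurable_fun [set: n.-tuple R] W -> (forall x, I (W x)) ->
  (forall i, measurable_fun [set: n.-tuple R] (V i)) -> (forall i x, I (V i x)) ->
  (forall i x t, V i (upd x i t) = V i x) ->
  \int[P]_w Phi (W (sample w)) - \int[P]_w Phi (partial_ints W s (sample w)) <=
  \sum_(i <- s) \int[P]_w D (W (sample w)) (V i (sample w)).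
Proof.
elim: s W V => [|i s IH] W V mW IW mV IV VV; first by rewrite big_nil subrr.
rewrite big_cons /=.
have [mW' IW'] := bounded_measurable_in_range mW IW i.
have mV' j := (bounded_measurable_in_range (mV j) (IV j) i).1.
have IV' j := (bounded_measurable_in_range (mV j) (IV j) i).2.
have VV' j x t : partial_int i (V j) (upd x j t) = partial_int i (V j) x.
  exact: partial_int_invariant.
have {IH} := IH _ (fun j => partial_int i (V j)) mW' IW' mV' IV' VV'.
have H1 : \int[P]_w Phi (W (sample w)) - \int[P]_w Phi (partial_int i W (sample w))
    <= \int[P]_w D (W (sample w)) (V i (sample w)).
  rewrite (resample i (g := Phi \o W)); last exact: bounded_Phi.
  rewrite (resample i (g := fun x => D (W x) (V i x))); last exact: bounded_bregman.
  have b1 : bounded_measurable (fun w => partial_int i (Phi \o W) (sample w)).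
    by apply/bounded_sample/bounded_partial_int; exact: bounded_Phi.
  have b2 : bounded_measurable (fun w => Phi (partial_int i W (sample w))).
    by apply/(bounded_sample (g := Phi \o _)); exact: bounded_Phi.
  rewrite -RintegralB//; try exact: bounded_measurable_integrable.
  apply: le_Rintegral_bounded => [||w].
  - exact: bounded_measurableB.
  - by apply/bounded_sample/bounded_partial_int; exact: bounded_bregman.
  - rewrite /partial_int; under [leRHS]eq_Rintegral do rewrite VV.
    apply: Phi_entropy_le_bregman => //.
    by have [] := bounded_upd (sample w) i (bounded_in_range mW IW).
have H2 : \sum_(j <- s) \int[P]_w D (partial_int i W (sample w))
  (partial_int i (V j) (sample w))
   <= \sum_(j <- s) \int[P]_w D (W (sample w)) (V j (sample w)).
  apply: ler_sum => j _.
  rewrite [leRHS](resample i (g := fun x => D (W x) (V j x)));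
    last exact: bounded_bregman.
  apply: le_Rintegral_bounded => [||w].
  - by apply: (bounded_sample (g :=
    fun x => D (partial_int i W x) (partial_int i (V j) x)));
      exact: bounded_bregman.
  - by apply/bounded_sample/bounded_partial_int; exact: bounded_bregman.
  - apply: bregman_Jensen => //.
    + by have [] := bounded_upd (sample w) i (bounded_in_range mW IW).
    + by have [] := bounded_upd (sample w) i (bounded_in_range (mV j) (IV j)).
by move: H1 H2; rewrite /partial_ints /=; lra.
Qed.

Let Rintegral_partial_ints s W : bounded_measurable W ->
  \int[P]_w W (sample w) = \int[P]_w partial_ints W s (sample w).
Proof.
elim: s W => [//|i s IH] W bW /=; rewrite (resample i bW) IH//.
exact: bounded_partial_int.
Qed.

Let partial_ints_invariant s W j : (j \in s) \/ (forall x t, W (upd x j t) = W x) ->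
  forall x t, partial_ints W s (upd x j t) = partial_ints W s x.
Proof.
elim: s W => [|i s IH] W /=; first by case.
move=> h; apply: IH; case: (eqVneq j i) h => [-> _|ji].
  by right=> x t; exact: partial_int_upd.
rewrite inE (negbTE ji) => -[|h]; [by left|right].
exact: partial_int_invariant.
Qed.

Lemma Phi_entropy_tensorization (W : n.-tuple R -> R) (V : 'I_n -> n.-tuple R ->
  R) :
  measurable_fun [set: n.-tuple R] W -> (forall x, I (W x)) ->
  (forall i, measurable_fun [set: n.-tuple R] (V i)) -> (forall i x, I (V i x)) ->
  (forall i x t, V i (upd x i t) = V i x) ->
  \int[P]_w Phi (W (sample w)) - Phi (\int[P]_w W (sample w)) <=
  \sum_i \int[P]_w D (W (sample w)) (V i (sample w)).
Proof.
move=> mW IW mV IV VV.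
have := tensorization_seq (index_enum _) mW IW mV IV VV.
have bW := bounded_in_range mW IW.
rewrite (Rintegral_partial_ints (index_enum _) bW).
set W' := partial_ints W _ => h.
(* Every coordinate has been integrated out, so [W'] is a constant, namely the mean. *)
have W'c x y : W' x = W' y.
  apply: upd_invariant_cst => i {}x t; apply: partial_ints_invariant; left.
  exact: mem_index_enum.
pose x0 := [tuple (0 : R) | i < n].
apply: le_trans h; rewrite lerD2l lerN2.
under eq_Rintegral do rewrite (W'c _ x0).
under [X in _ <= Phi X]eq_Rintegral do rewrite (W'c _ x0).
by rewrite !Rintegral_probability_cst.
Qed.

End bregman.

End resampling.

(** * Efron-Stein and modified logarithmic Sobolev inequalities for order statistics *)

Section order_statistics_of_tuples.
Context {R : realType} {n : nat}.
Local Notation full := (finset.setTfor 'I_n : {set 'I_n}).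

Lemma measurable_sub_order_stat (A : {set 'I_n}) k : (0 < k <= #|A|)%N ->
  measurable_fun [set: n.-tuple R] (fun x => sub_order_stat A k (tnth x)).
Proof.
move=> kA _; apply: (measurability _ (RGenOInfty.measurableE R)) => //.
move=> /= _ [_ [t ->] <-]; rewrite preimage_itvoy setTI.
pose good := [set S : {set 'I_n} | (S \subset A) && (k <= #|S|)%N].
rewrite [X in measurable X](_ : _ = \bigcup_(S in good)
    \bigcap_(i in [set` S]) [set x : n.-tuple R | t < tnth x i]).
  apply: fin_bigcup_measurable => [|S _]; first exact: finite_finset.
  apply: fin_bigcap_measurable => [|i _]; first exact: finite_finset.
  rewrite -[X in measurable X]setTI -(preimage_itvoy (fun x : n.-tuple R => tnth x
    i)).
  exact: measurable_tnth.
apply/seteqP; split => [x /=|x [S /= /andP[SA kS] h]].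
  rewrite lt_sub_order_stat// => h.
  exists [set i in A | t < tnth x i]%SET => [|i /=]; last first.
    by rewrite finset.inE => /andP[].
  apply/andP; split; last exact: h.
  by apply/fintype.subsetP => i; rewrite finset.inE => /andP[].
rewrite /= lt_sub_order_stat//; apply: leq_trans kS _; apply: subset_leq_card.
by apply/fintype.subsetP => i iS; rewrite !inE (fintype.subsetP SA)//=; exact: h.
Qed.

Lemma sub_order_stat_upd (A : {set 'I_n}) k i (x : n.-tuple R) t : i \notin A ->
  sub_order_stat A k (tnth (upd x i t)) = sub_order_stat A k (tnth x).
Proof.
move=> iA; rewrite /sub_order_stat; congr nth; congr sort.
apply/eq_in_map => j; rewrite mem_enum tnth_upd; case: eqP => // ->.
by rewrite (negbTE iA).
Qed.

End order_statistics_of_tuples.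

Definition clip {R : realType} (m x : R) : R := Num.max (- m) (Num.min x m).

Section clip.
Context {R : realType}.
Implicit Types m x y : R.

Lemma clip_le m x y : x <= y -> clip m x <= clip m y.
Proof.
by move=> xy; rewrite /clip; case: (leP x m); case: (leP y m) => ? ?;
  rewrite le_max ?ge_max; lra.
Qed.

Lemma clip_range m x : 0 <= m -> - m <= clip m x <= m.
Proof.
by move=> m0; rewrite /clip le_max ge_max ge_min !lexx orbT andbT ge0_cp.
Qed.

Lemma clip_lipschitz m x y : y <= x -> 0 <= clip m x - clip m y <= x - y.
Proof.
move=> yx; rewrite subr_ge0 clip_le//=.
by rewrite /clip; case: (leP x m); case: (leP y m); case: (leP (- m) x);
  case: (leP (- m) y); case: (leP (- m) m); lra.
Qed.

Lemma measurable_clip m : measurable_fun [set: R] (clip m).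
Proof. by apply: measurable_maxr => //; apply: measurable_minr. Qed.

Lemma clip_le_min m x : 0 <= m -> - m <= x -> clip m x = Num.min x m.
Proof. by rewrite /clip; case: (leP x m); case: (leP (- m) x); case: (leP (- m) m);
  lra. Qed.

End clip.

Section tensorized_order_statistics.
Context {R : realType} {d : measure_display} {T : measurableType d}.
Context {P : probability T R} {n : nat}.
Variable X : 'I_n -> {RV P >-> R}.
Hypothesis indepX : mutually_independent X.
Variable k : nat.
Hypotheses (k_gt0 : (0 < k)%N) (k_lt_n : (k < n)%N).
Local Notation full := (finset.setTfor 'I_n : {set 'I_n}).

Let ck : (0 < k <= #|full|)%N.
Proof. by rewrite k_gt0 cardsT card_ord ltnW. Qed.
Let ckS : (0 < k.+1 <= #|full|)%N.
Proof. by rewrite cardsT card_ord. Qed.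
Let cki (i : 'I_n) : (0 < k <= #|[set~ i]%SET|)%N.
Proof. by rewrite k_gt0 cardsC1 card_ord; lia. Qed.

Lemma order_stat_sample j w :
  sub_order_stat full j (tnth (sample X w)) = order_stat (fun i => X i : T ->
    R) j w.
Proof.
rewrite order_stat_sub; congr sub_order_stat.
by apply/funext => i; rewrite tnth_sample.
Qed.

Lemma measurable_order_stat j : (0 < j <= n)%N ->
  measurable_fun [set: T] (order_stat (fun i => X i : T -> R) j).
Proof.
move=> jn; rewrite (_ : order_stat _ _ =
  (fun x => sub_order_stat full j (tnth x)) \o sample X); last first.
  by apply/funext => w; rewrite /= order_stat_sample.
apply: measurableT_comp; last exact: measurable_sample.
by apply: measurable_sub_order_stat; rewrite cardsT card_ord.
Qed.

Local Notation Z := (order_stat (fun i => X i : T -> R) k).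
Local Notation Y := (order_stat (fun i => X i : T -> R) k.+1).

Lemma order_stat_le w : Y w <= Z w.
Proof. by rewrite !order_stat_sub; exact: le_consecutive. Qed.

Let Zi (i : 'I_n) (x : n.-tuple R) := sub_order_stat [set~ i]%SET k (tnth x).

Section divergence.
Variables (D : R -> R -> R) (lo hi : R) (phi : R -> R).
Hypothesis phi_range : forall x, lo <= phi x <= hi.
Hypothesis phi_le : forall x y, x <= y -> phi x <= phi y.
Hypothesis D_diag : forall a, D a a = 0.

Lemma sum_loo_upper w : (forall a b b',
  lo <= b -> b <= b' -> b' <= a -> D a b' <= D a b) ->
  \sum_i D (phi (Z w)) (phi (Zi i (sample X w))) <=
    k%:R * D (phi (Z w)) (phi (Y w)).
Proof.
move=> D_anti.
rewrite !order_stat_sub.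
have e : X ^~ w = tnth (sample X w) by apply/funext => i; rewrite tnth_sample.
rewrite [X ^~ w]e; set z := tnth _.
have D0 : 0 <= D (phi (sub_order_stat full k z)) (phi (sub_order_stat full k.+1 z)).
  rewrite -(D_diag (phi (sub_order_stat full k z))); apply: D_anti => //.
    by case/andP: (phi_range (sub_order_stat full k.+1 z)).
  by apply: phi_le; exact: le_consecutive.
rewrite (bigID (fun i => sub_order_stat full k.+1 z < z i))/= [X in _ + X]big1
  ?addr0; last first.
  by move=> i; rewrite -leNgt => zi; rewrite /Zi (loo_low k_gt0 k_lt_n).
apply: (@le_trans _ _ (\sum_(i | sub_order_stat full k.+1 z < z i)
    D (phi (sub_order_stat full k z)) (phi (sub_order_stat full k.+1 z)))).
  apply: ler_sum => i _; apply: D_anti.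
  - by case/andP: (phi_range (sub_order_stat full k.+1 z)).
  - by apply: phi_le; exact: le_loo.
  - by apply: phi_le; exact: loo_le.
rewrite sumr_const -[_ *+ _]mulr_natl ler_wpM2r// ler_nat.
apply: leq_trans (card_above z k_lt_n).
by apply: subset_leq_card; apply/fintype.subsetP => i; rewrite !inE.
Qed.

(** The statistic of rank [k] of the reduced sample now approximates X_(k+1) from above. This is the
    version that serves ranks beyond [n / 2]. *)
Lemma sum_loo_lower w : (forall a b b',
  b <= hi -> b' <= b -> a <= b' -> D a b' <= D a b) ->
  \sum_i D (phi (Y w)) (phi (Zi i (sample X w))) <=
    (n - k)%:R * D (phi (Y w)) (phi (Z w)).
Proof.
move=> D_mono.
rewrite !order_stat_sub.
have e : X ^~ w = tnth (sample X w) by apply/funext => i; rewrite tnth_sample.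
rewrite [X ^~ w]e; set z := tnth _.
have D0 : 0 <= D (phi (sub_order_stat full k.+1 z)) (phi (sub_order_stat full k z)).
  rewrite -(D_diag (phi (sub_order_stat full k.+1 z))); apply: D_mono => //.
    by case/andP: (phi_range (sub_order_stat full k z)).
  by apply: phi_le; exact: le_consecutive.
rewrite (bigID (fun i => z i < sub_order_stat full k z))/= [X in _ + X]big1 ?addr0;
  last first.
  by move=> i; rewrite -leNgt => zi; rewrite /Zi (loo_high k_gt0 k_lt_n).
apply: (@le_trans _ _ (\sum_(i | z i < sub_order_stat full k z)
    D (phi (sub_order_stat full k.+1 z)) (phi (sub_order_stat full k z)))).
  apply: ler_sum => i _; apply: D_mono.
  - by case/andP: (phi_range (sub_order_stat full k z)).
  - by apply: phi_le; exact: loo_le.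
  - by apply: phi_le; exact: le_loo.
rewrite sumr_const -[_ *+ _]mulr_natl ler_wpM2r// ler_nat.
apply: leq_trans (card_below z k_gt0 k_lt_n).
by apply: subset_leq_card; apply/fintype.subsetP => i; rewrite !inE.
Qed.

End divergence.

Section Phi_entropy.
Variables (Phi dPhi : R -> R) (lo hi : R) (phi : R -> R).
Let I : pred R := fun a => lo <= a <= hi.
Let D a b := Phi a - Phi b - dPhi b * (a - b).
Hypothesis mPhi : measurable_fun [set: R] Phi.
Hypothesis mdPhi : measurable_fun [set: R] dPhi.
Hypothesis bPhi : exists M : R, forall a, I a -> `|Phi a| <= M.
Hypothesis bdPhi : exists M : R, forall a, I a -> `|dPhi a| <= M.
Hypothesis D_ge0 : forall a b, I a -> I b -> 0 <= D a b.
Hypothesis D_convex : forall a0 b0, I a0 -> I b0 -> exists c1 c2 c3,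
  D a0 b0 = c1 * a0 + c2 * b0 + c3 /\
  forall a b, I a -> I b -> c1 * a + c2 * b + c3 <= D a b.
Hypothesis mphi : measurable_fun [set: R] phi.
Hypothesis phi_range : forall x, I (phi x).
Hypothesis phi_le : forall x y, x <= y -> phi x <= phi y.

Let D_diag a : D a a = 0.
Proof. by rewrite /D !subrr mulr0 subrr. Qed.

Let mos (A : {set 'I_n}) j : (0 < j <= #|A|)%N ->
  measurable_fun [set: n.-tuple R] (fun x => phi (sub_order_stat A j (tnth x))).
Proof. by move=> jA; apply: measurableT_comp => //;
  exact: measurable_sub_order_stat. Qed.

Let bD (f g : n.-tuple R -> R) : measurable_fun [set: n.-tuple R] f ->
  measurable_fun [set: n.-tuple R] g -> (forall x, I (f x)) -> (forall x,
    I (g x)) ->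
  bounded_measurable (fun w => D (f (sample X w)) (g (sample X w))).
Proof.
move=> mf mg If Ig; apply: (bounded_measurable_comp (g :=
  fun x => D (f x) (g x)) (measurable_sample X)).
exact: (bounded_bregman mPhi mdPhi bPhi bdPhi).
Qed.

Let tensorized j (c : R) (E : T -> R) : (0 < j <= #|full|)%N ->
  bounded_measurable E ->
  (forall w, \sum_i D (phi (order_stat (fun i => X i : T ->
    R) j w)) (phi (Zi i (sample X w)))
     <= c * E w) ->
  \int[P]_w Phi (phi (order_stat (fun i => X i : T -> R) j w)) -
    Phi (\int[P]_w phi (order_stat (fun i => X i : T ->
      R) j w)) <= c * \int[P]_w E w.
Proof.
move=> jn bE h.
under eq_Rintegral do rewrite -order_stat_sample.
under [X in _ - Phi X]eq_Rintegral do rewrite -order_stat_sample.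
apply: (le_trans (Phi_entropy_tensorization indepX mPhi mdPhi bPhi bdPhi D_ge0
  D_convex (mos jn) (fun x => phi_range _) (fun i => mos (cki i))
  (fun i x => phi_range _) _)).
  by move=> i x t; rewrite sub_order_stat_upd// !finset.inE eqxx.
have bDi i := bD (mos jn) (mos (cki i)) (fun=> phi_range _) (fun=> phi_range _).
rewrite -Rintegral_sum; last by move=> i; exact: bDi.
rewrite -(RintegralZl _ measurableT (bounded_measurable_integrable P bE)).
apply: le_Rintegral_bounded.
- by apply: bounded_measurable_sum => i; exact: bDi.
- exact: bounded_measurableZ.
- by move=> w /=; rewrite order_stat_sample; exact: h.
Qed.

Lemma Phi_entropy_upper :
  (forall a b b', lo <= b -> b <= b' -> b' <= a -> D a b' <= D a b) ->
  \int[P]_w Phi (phi (Z w)) - Phi (\int[P]_w phi (Z w)) <=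
  k%:R * \int[P]_w D (phi (Z w)) (phi (Y w)).
Proof.
move=> D_anti; apply: tensorized => //.
  have := bD (mos ck) (mos ckS) (fun x => phi_range _) (fun x => phi_range _).
  by under eq_fun do rewrite !order_stat_sample.
by move=> w; exact: (@sum_loo_upper D lo hi).
Qed.

Lemma Phi_entropy_lower :
  (forall a b b', b <= hi -> b' <= b -> a <= b' -> D a b' <= D a b) ->
  \int[P]_w Phi (phi (Y w)) - Phi (\int[P]_w phi (Y w)) <=
  (n - k)%:R * \int[P]_w D (phi (Y w)) (phi (Z w)).
Proof.
move=> D_mono; apply: tensorized => //.
  have := bD (mos ckS) (mos ck) (fun x => phi_range _) (fun x => phi_range _).
  by under eq_fun do rewrite !order_stat_sample.
by move=> w; exact: (@sum_loo_lower D lo hi).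
Qed.

End Phi_entropy.

Section clipped.
Variable m : R.
Hypothesis m_ge0 : 0 <= m.

Let sqr_hyps : [/\
  exists M : R, forall a : R, - m <= a <= m -> `|a ^+ 2| <= M,
  exists M : R, forall a : R, - m <= a <= m -> `|2 * a| <= M,
  (forall a b : R, - m <= a <= m -> - m <= b <= m ->
    0 <= a ^+ 2 - b ^+ 2 - 2 * b * (a - b)) &
  forall a0 b0 : R, - m <= a0 <= m -> - m <= b0 <= m -> exists c1 c2 c3,
  a0 ^+ 2 - b0 ^+ 2 - 2 * b0 * (a0 - b0) = c1 * a0 + c2 * b0 + c3 /\
  forall a b, - m <= a <= m -> - m <= b <= m ->
    c1 * a + c2 * b + c3 <= a ^+ 2 - b ^+ 2 - 2 * b * (a - b)].
Proof.
split.
- exists (m ^+ 2) => a am; rewrite normrX ler_sqr ?nnegrE//;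
  first by rewrite ler_norml.
- by exists (2 * m) => a am; rewrite normrM ger0_norm// ler_wpM2l// ler_norml.
- by move=> a b _ _; have := sqr_ge0 (a - b); lra.
(* Here the divergence is [(a - b) ^+ 2], and the minorant is its tangent at [a - b = c]. *)
- move=> a0 b0 _ _; pose c := a0 - b0.
  exists (2 * c), (- (2 * c)), (- c ^+ 2); split; first by rewrite /c; ring.
  by move=> a b _ _; have := sqr_ge0 (a - b - c); lra.
Qed.

Lemma efron_stein_upper :
  \int[P]_w clip m (Z w) ^+ 2 - (\int[P]_w clip m (Z w)) ^+ 2 <=
  k%:R * \int[P]_w (clip m (Z w) - clip m (Y w)) ^+ 2.
Proof.
case: sqr_hyps => h1 h2 h3 h4.
have := @Phi_entropy_upper (fun a => a ^+ 2) (fun a => 2 * a) (- m) m (clip m)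
  (@exprn_measurable R setT 2)
    (@mulrl_measurable R setT 2) h1 h2 h3 h4 (measurable_clip m)
  (fun x => clip_range x m_ge0) (@clip_le _ m).
have -> : \int[P]_w (clip m (Z w) - clip m (Y w)) ^+ 2 =
    \int[P]_w (clip m (Z w) ^+ 2 - clip m (Y w) ^+ 2 -
      2 * clip m (Y w) * (clip m (Z w) - clip m (Y w))).
  by apply: eq_Rintegral => w _; ring.
by apply => a b b' *; nra.
Qed.

Lemma efron_stein_lower :
  \int[P]_w clip m (Y w) ^+ 2 - (\int[P]_w clip m (Y w)) ^+ 2 <=
  (n - k)%:R * \int[P]_w (clip m (Z w) - clip m (Y w)) ^+ 2.
Proof.
case: sqr_hyps => h1 h2 h3 h4.
have := @Phi_entropy_lower (fun a => a ^+ 2) (fun a => 2 * a) (- m) m (clip m)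
  (@exprn_measurable R setT 2)
    (@mulrl_measurable R setT 2) h1 h2 h3 h4 (measurable_clip m)
  (fun x => clip_range x m_ge0) (@clip_le _ m).
have -> : \int[P]_w (clip m (Z w) - clip m (Y w)) ^+ 2 =
    \int[P]_w (clip m (Y w) ^+ 2 - clip m (Z w) ^+ 2 -
      2 * clip m (Z w) * (clip m (Y w) - clip m (Z w))).
  by apply: eq_Rintegral => w _; ring.
by apply => a b b' *; nra.
Qed.

Let le_ln_mul (a b : R) : 0 < a -> 0 < b -> a * (ln b - ln a) <= b - a.
Proof.
move=> a0 b0; rewrite -ln_div ?posrE//.
have := @le_ln1Dx R (b / a - 1); rewrite subrKC.
have ba : 0 < b / a by rewrite divr_gt0.
move=> /(_ _)/(ler_wpM2l (ltW a0));
  rewrite mulrBr mulr1 mulrCA divff ?gt_eqF// mulr1.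
by apply; lra.
Qed.

Variable u : R.
Hypothesis u_ge0 : 0 <= u.
Let phi x := expR (u * clip m x).
Let lo := expR (- (u * m)).
Let hi := expR (u * m).

Let phi_range x : lo <= phi x <= hi.
Proof.
have /andP[a b] := clip_range x m_ge0.
by rewrite !ler_expR -mulrN !ler_wpM2l.
Qed.

Lemma entropy_upper :
  \int[P]_w (expR (u * clip m (Z w)) * (u * clip m (Z w))) -
    (\int[P]_w expR (u * clip m (Z w))) * ln (\int[P]_w expR (u * clip m (Z w))) <=
  k%:R * \int[P]_w (expR (u * clip m (Y w)) * psi (u * clip m (Z w) - u * clip m
    (Y w))).
Proof.
have lo0 a : lo <= a -> 0 < a by apply: lt_le_trans; exact: expR_gt0.
have bln a : lo <= a <= hi -> `|ln a| <= u * m.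
  move=> /andP[la ah]; rewrite ler_norml.
  by apply/andP; split; rewrite -ler_expR lnK ?posrE ?lo0.
have h1 : exists M : R, forall a, lo <= a <= hi -> `|a * ln a| <= M.
  exists (hi * (u * m)) => a la; rewrite normrM ler_pM ?bln//.
  by case/andP: la => /lo0 a0; rewrite gtr0_norm.
have h2 : exists M : R, forall a, lo <= a <= hi -> `|1 + ln a| <= M.
  by exists (1 + u * m) => a /bln la;
    rewrite (le_trans (ler_normD _ _))// normr1 lerD2l.
have h3 a b : lo <= a <= hi -> lo <= b <= hi ->
    0 <= a * ln a - b * ln b - (1 + ln b) * (a - b).
  by move=> /andP[/lo0 a0 _] /andP[/lo0 b0 _]; have := le_ln_mul a0 b0; lra.
have h4 a0 b0 : lo <= a0 <= hi -> lo <= b0 <= hi -> exists c1 c2 c3,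
    a0 * ln a0 - b0 * ln b0 - (1 + ln b0) * (a0 - b0) = c1 * a0 + c2 * b0 + c3 /\
    forall a b, lo <= a <= hi -> lo <= b <= hi ->
      c1 * a + c2 * b + c3 <= a * ln a - b * ln b - (1 + ln b) * (a - b).
  move=> /andP[/lo0 a00 _] /andP[/lo0 b00 _].
  (* The gradient at [(a0, b0)] of the divergence [a * ln (a / b) - a + b]; this function is
     homogeneous of degree one, so its tangent plane has no constant term. *)
  exists (ln a0 - ln b0), (1 - a0 / b0), 0; split; first by field; rewrite gt_eqF.
  move=> a b /andP[/lo0 pa _] /andP[/lo0 pb _].
  have r0 : 0 < a0 / b0 by rewrite divr_gt0.
  have := le_ln_mul pa (mulr_gt0 pb r0).
  by rewrite lnM ?posrE// ln_div ?posrE//; lra.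
have mphi : measurable_fun [set: R] phi.
  apply: measurableT_comp => //; apply: measurable_funM => //.
  exact: measurable_clip.
have phi_le x y : x <= y -> phi x <= phi y.
  by move=> xy; rewrite ler_expR ler_wpM2l// clip_le.
have mPhi : measurable_fun [set: R] (fun a => a * ln a).
  by apply: measurable_funM => //; exact: measurable_ln.
have mdPhi : measurable_fun [set: R] (fun a => 1 + ln a).
  by apply: measurable_funD => //; exact: measurable_ln.
have := @Phi_entropy_upper (fun a => a * ln a) (fun a => 1 + ln a) lo hi phi
  mPhi mdPhi h1 h2 h3 h4 mphi phi_range phi_le.
have -> : \int[P]_w (phi (Z w) * ln (phi (Z w))) =
    \int[P]_w (expR (u * clip m (Z w)) * (u * clip m (Z w))).
  by apply: eq_Rintegral => w _; rewrite expRK.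
have -> : \int[P]_w (phi (Z w) * ln (phi (Z w)) - phi (Y w) * ln (phi (Y w)) -
      (1 + ln (phi (Y w))) * (phi (Z w) - phi (Y w))) =
    \int[P]_w (expR (u * clip m (Y w)) * psi (u * clip m (Z w) - u * clip m (Y w))).
  apply: eq_Rintegral => w _; rewrite !expRK /psi.
  have -> : phi (Z w) = phi (Y w) * expR (u * clip m (Z w) - u * clip m (Y w)).
    by rewrite -expRD subrKC.
  by rewrite /phi; ring.
apply => a b b' /lo0 b0 bb' b'a.
have b'0 : 0 < b' by exact: lt_le_trans bb'.
have := le_ln_mul b'0 b0.
have : ln b <= ln b' by rewrite ler_ln ?posrE.
by nra.
Qed.

End clipped.
End tensorized_order_statistics.

(** * Herbst's argument *)

Section herbst.
Context {R : realType} {d : measure_display} {T : measurableType d}.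
Variables (P : probability T R) (V : T -> R) (a0 b0 : R).
Hypothesis bV : bounded_measurable V.
Hypotheses (a0_ge0 : 0 <= a0) (b0_ge0 : 0 <= b0).

Lemma bounded_measurable_expR (f : T -> R) : bounded_measurable f ->
  bounded_measurable (fun w => expR (f w)).
Proof.
move=> [mf [K fK]]; apply: (@bounded_measurable_range _ _ _ 0 (expR K)).
  exact: measurableT_comp.
by move=> x; rewrite expR_ge0 ler_expR (le_trans (ler_norm _)).
Qed.

Let M t := \int[P]_w expR (t * V w).

Let bE t : bounded_measurable (fun w => expR (t * V w)).
Proof. by apply: bounded_measurable_expR; exact: bounded_measurableZ. Qed.

Let M_gt0 t : 0 < M t.
Proof.
have [_ [K VK]] := bV.
apply: (@lt_le_trans _ _ (expR (- (`|t| * K)))); first exact: expR_gt0.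
rewrite -[leLHS](Rintegral_probability_cst P); apply: le_Rintegral_bounded => //.
  exact: bounded_measurable_cst.
move=> x; rewrite ler_expR lerNl (le_trans (ler_norm _))// normrN normrM.
by rewrite ler_wpM2l.
Qed.

Hypothesis entropy_le : forall t, 0 < t <= 1 ->
  \int[P]_w (expR (t * V w) * (t * V w)) - M t * ln (M t) <=
  (t ^+ 2 * a0 + t ^+ 3 * b0) * M t.

(** Convexity of [ln M] in tangent form. The slope is the mean of [V] under the law tilted by
    [expR (t * V)], and [expR y >= 1 + y] at [y = (s - t) * (V w - v)] integrates to the claim. *)
Let log_laplace_tangent s t :
  ln (M t) + (s - t) * (\int[P]_w (expR (t * V w) * V w) / M t) <= ln (M s).
Proof.
set v := _ / M t.
have bEV : bounded_measurable (fun w => expR (t * V w) * V w).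
  exact: bounded_measurableM.
rewrite -ler_expR expRD !lnK ?posrE//.
have -> : M t * expR ((s - t) * v) =
    \int[P]_w (expR ((s - t) * v) * (expR (t * V w) * (1 - (s - t) * v) + (s - t)
      * (expR (t * V w) * V w))).
  rewrite RintegralZl//; last first.
    apply: bounded_measurable_integrable; apply: bounded_measurableD;
      last exact: bounded_measurableZ.
    by apply: bounded_measurableM => //; exact: bounded_measurable_cst.
  rewrite mulrC; congr (_ * _); rewrite RintegralD//; last 2 first.
  - apply: bounded_measurable_integrable.
    by apply: bounded_measurableM => //; exact: bounded_measurable_cst.
  - by apply: bounded_measurable_integrable; exact: bounded_measurableZ.
  rewrite RintegralZr ?RintegralZl//; try exact: bounded_measurable_integrable.
  have -> : \int[P]_w (expR (t * V w) * V w) = v * M t by rewrite /v divfK ?gt_eqF.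
  by rewrite -/(M t); ring.
apply: le_Rintegral_bounded => //.
  apply: bounded_measurableZ; apply: bounded_measurableD;
    last exact: bounded_measurableZ.
  by apply: bounded_measurableM => //; exact: bounded_measurable_cst.
move=> w.
have -> : expR (s * V w) =
  expR ((s - t) * v) * (expR (t * V w) * expR ((s - t) * (V w - v))).
  by rewrite -!expRD; congr expR; ring.
rewrite ler_wpM2l ?expR_ge0//.
have := expR_ge1Dx ((s - t) * (V w - v)); have := expR_gt0 (t * V w); nra.
Qed.

(** Finite-difference form of Herbst's identity: the derivative of [ln (M t) / t] is the entropy
    divided by [t ^+ 2 * M t], hence at most [a0 + t * b0]. The denominator [s] in place of [t] is a
    second-order error. *)
Let rescaled_step s t : 0 < s -> s <= t -> t <= 1 ->
  ln (M t) / t - ln (M s) / s <= (t - s) / s * (t * a0 + t ^+ 2 * b0).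
Proof.
move=> s0 st t1.
have t0 : 0 < t := lt_le_trans s0 st.
have bEV : bounded_measurable (fun w => expR (t * V w) * V w).
  exact: bounded_measurableM.
have ent : t * (\int[P]_w (expR (t * V w) * V w) / M t) - ln (M t) <=
  t ^+ 2 * a0 + t ^+ 3 * b0.
  rewrite -(ler_pM2r (M_gt0 t)); apply: le_trans (entropy_le _); last by rewrite t0.
  rewrite mulrBl -mulrA divfK ?gt_eqF// [leLHS]addrC [leRHS]addrC.
  rewrite [ln _ * _]mulrC lerD2l -RintegralZl//;
    last exact: bounded_measurable_integrable.
  by under eq_Rintegral do rewrite mulrCA.
have := log_laplace_tangent s t; move: ent; set v := _ / M t => ent tan.
have h1 : ln (M t) / t - ln (M s) / s <= (t - s) / s * ((t * v - ln (M t)) / t).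
  have -> : (t - s) / s * ((t * v - ln (M t)) / t) =
     ln (M t) / t - (ln (M t) + (s - t) * v) / s by field; rewrite !gt_eqF.
  by rewrite lerD2l lerN2 ler_pM2r ?invr_gt0.
apply: (le_trans h1); rewrite ler_wpM2l//;
  first by rewrite divr_ge0 ?subr_ge0// ltW.
by rewrite ler_pdivrMr//; lra.
Qed.

(** Quantitative substitute for the limit of [ln (M e) / e] at [0], which is the mean of [V]. *)
Let log_laplace_small e : 0 < e -> (forall w, e * V w <= 1 / 2) ->
  forall K, (forall w, `|V w| <= K) ->
    ln (M e) / e <= \int[P]_w V w + 2 * e * K ^+ 2.
Proof.
move=> e0 eV K VK; rewrite ler_pdivrMr//.
have bc c : bounded_measurable (fun _ : T => c : R) by exact:
  bounded_measurable_cst.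
have : M e <= \int[P]_w (1 + 2 * e ^+ 2 * K ^+ 2 + e * V w).
  apply: le_Rintegral_bounded => //.
    by apply: bounded_measurableD => //; exact: bounded_measurableZ.
  move=> w; apply: (le_trans (expR_le_quadratic (eV w))).
  have : V w ^+ 2 <= K ^+ 2.
    rewrite -(ger0_norm (sqr_ge0 (V w))) normrX ler_sqr ?nnegrE//.
    exact: le_trans (VK w).
  rewrite exprMn => /(ler_wpM2l (sqr_ge0 e)); lra.
have iV := bounded_measurable_integrable P bV.
have ieV := bounded_measurable_integrable P (bounded_measurableZ e bV).
have ic := bounded_measurable_integrable P (bc (1 + 2 * e ^+ 2 * K ^+ 2)).
rewrite RintegralD// RintegralZl// Rintegral_probability_cst.
have := @le_ln1Dx R (M e - 1); rewrite subrKC => /(_ _).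
have := M_gt0 e => M0; have -> : -1 < M e - 1 by lra.
by move=> /(_ isT); lra.
Qed.

Lemma herbst : ln (\int[P]_w expR (V w)) <= \int[P]_w V w + a0 + b0 / 2.
Proof.
have -> : \int[P]_w expR (V w) = M 1 by apply: eq_Rintegral => w _; rewrite mul1r.
have [_ [K VK]] := bV.
have K0 : 0 <= K := le_trans (normr_ge0 _) (VK point).
rewrite -subr_le0; apply: (@le0_of_le_div _ _ (2 * K ^+ 2)) => N.
(* Chosen so that both [e <= N.+1%:R^-1] and [e * K <= 1 / 2] hold. *)
pose e : R := ((2 * K + 1) * N.+1%:R)^-1.
have N1 : 1 <= N.+1%:R :> R by rewrite ler1n.
have e0 : 0 < e by rewrite invr_gt0 mulr_gt0//; lra.
have eN : e <= N.+1%:R^-1.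
  by rewrite lef_pV2 ?posrE ?ltr0n//; [nra|rewrite -invr_gt0].
have eK : e * (2 * K + 1) <= 1.
  by rewrite /e invfM mulrAC mulVf ?mul1r ?invf_le1// ?ltr0n// gt_eqF//; lra.
have e1 : e <= 1 by apply: le_trans eN _; rewrite invf_le1 ?ltr0n.
have eV w : e * V w <= 1 / 2.
  have := le_trans (ler_norm _) (VK w) => /(ler_wpM2l (ltW e0)); lra.
have small := log_laplace_small e0 eV VK.
suff : ln (M 1) / 1 - a0 * 1 - b0 / 2 * 1 ^+ 2 <=
  ln (M e) / e - a0 * e - b0 / 2 * e ^+ 2.
  rewrite divr1 expr1n !mulr1.
  have : 2 * e * K ^+ 2 <= 2 * K ^+ 2 / N.+1%:R.
    by have := sqr_ge0 K; move: eN; set i := _^-1 => *; nra.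
  have : 0 <= a0 * e by rewrite mulr_ge0// ltW.
  have : 0 <= b0 / 2 * e ^+ 2 by rewrite mulr_ge0 ?sqr_ge0// divr_ge0.
  move: small; set x := ln (M e) / e; set y := 2 * e * K ^+ 2.
  by set z := 2 * K ^+ 2 / _; set v := b0 / 2 * _; lra.
(* The primitive of [a0 + t * b0] is subtracted; the interval starts at [e], which keeps the
   constant in the quadratic error finite. *)
apply: (@le_of_quadratic_increment _ (fun t => ln (M t) / t - a0 * t - b0 / 2 * t
  ^+ 2)
  _ _ ((a0 + b0) / e + b0 / 2)) => // s t es st t1.
have s0 : 0 < s := lt_le_trans e0 es.
have h := rescaled_step s0 st t1.
have -> : ln (M t) / t - a0 * t - b0 / 2 * t ^+ 2 - (ln (M s) / s - a0 * s - b0 /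
  2 * s ^+ 2)
  = ln (M t) / t - ln (M s) / s - (t - s) * (a0 + b0 / 2 * (t + s)) by field;
    rewrite !gt_eqF//; apply: lt_le_trans st.
apply: (@le_trans _ _ ((t - s) / s * (t * a0 + t ^+ 2 * b0) - (t - s) * (a0 + b0 /
  2 * (t + s)))).
  by rewrite lerD2r.
have -> : (t - s) / s * (t * a0 + t ^+ 2 * b0) - (t - s) * (a0 + b0 / 2 * (t + s)) =
  (t - s) ^+ 2 * ((a0 + t * b0) / s + b0 / 2) by field; rewrite gt_eqF.
rewrite [leRHS]mulrC ler_wpM2l ?sqr_ge0// lerD2r.
apply: ler_pM.
- by rewrite addr_ge0// mulr_ge0// (le_trans (ltW s0)).
- by rewrite invr_ge0 ltW.
- by rewrite lerD2l ler_piMl.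
- by rewrite lef_pV2 ?posrE.
Qed.

End herbst.

(** * Distribution functions with non-decreasing hazard rate *)

Section density.
Context {R : realType}.
Variables F f : R -> R.
Hypothesis densF : is_density_of f F.
Local Notation mu := (@lebesgue_measure R).

Let mf : measurable_fun [set: R] f. Proof. by case: densF. Qed.
Let f_ge0 x : 0 <= f x. Proof. by case: densF. Qed.

Lemma cdf_increment x y : x <= y ->
  ((F y - F x)%:E = \int[mu]_(t in `]x, y]) (f t)%:E)%E.
Proof.
move=> xy; have [_ _ FE] := densF.
have : ((F y)%:E = (F x)%:E + \int[mu]_(t in `]x, y]) (f t)%:E)%E.
  rewrite !FE (@itv_bndbnd_setU _ _ -oo%O (BRight x) (BRight y))//.
  rewrite ge0_integral_setU//=.
  - by apply/measurable_EFinP; exact: measurable_funTS.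
  - by move=> t _; rewrite lee_fin.
  - rewrite disj_set2E; apply/eqP; rewrite -subset0 => t /=.
    by rewrite !in_itv/= => -[tx /andP[]]; rewrite ltNge tx.
by rewrite EFinB => ->; rewrite addeAC subee// add0e.
Qed.

Lemma density_integrable x y : mu.-integrable `[x, y] (EFin \o f).
Proof.
have [_ _ FE] := densF.
apply: (@integrableS _ _ _ mu `]-oo, y]%classic) => //.
  by move=> t; rewrite /= !in_itv/= => /andP[].
apply/integrableP; split; first by apply/measurable_EFinP; exact: measurable_funTS.
under eq_integral do rewrite /= ger0_norm//.
by rewrite -FE ltry.
Qed.

Lemma cdf_nondecreasing_density x y : x <= y -> F x <= F y.
Proof.
move=> xy; rewrite -subr_ge0 -lee_fin cdf_increment//.
by apply: integral_ge0 => t _; rewrite lee_fin.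
Qed.

(** Left continuity is what excludes atoms, and with them ties in the sample. *)
Lemma cdf_cvg_left x : F y @[y --> x^'-] --> F x.
Proof.
have x1 : x - 1 < x by rewrite ltrBlDr ltrDl.
have cv := parameterized_integral_cvg_at_left x1 (density_integrable (x - 1) x).
have FE y : x - 1 <= y -> F y = parameterized_integral mu (x - 1) y f + F (x - 1).
  move=> xy; rewrite /parameterized_integral -Rintegral_itv_obnd_cbnd; last first.
    apply: integrableS (density_integrable (x - 1) y) => //.
    by move=> t; rewrite /= !in_itv/= => /andP[/ltW -> ->].
  by rewrite /Rintegral -cdf_increment//= subrK.
rewrite [X in _ --> X]FE ?(ltW x1)//.
apply: cvg_trans (cvgD cv (cvg_cst (F (x - 1)))).
apply: near_eq_cvg; near=> y; rewrite /= [RHS]FE//.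
by apply: ltW; near: y; exact: nbhs_left_gt.
Unshelve. all: by end_near. Qed.

Section bounds.
Hypothesis F_le1 : forall x, F x <= 1.
Hypothesis h_nondecr : nondecreasing_hazard_rate F f.
Local Notation h := (hazard_rate F f).
Let S x := 1 - F x.

Lemma hazard_rate_ge0 x : 0 <= h x.
Proof. by rewrite divr_ge0// subr_ge0. Qed.

Let densityE x : 0 < S x -> f x = h x * S x.
Proof. by move=> Sx; rewrite /hazard_rate divfK// gt_eqF. Qed.

Let integral_itv_cst x y (c : R) : x <= y ->
  (\int[mu]_(t in `]x, y]) c%:E = (c * (y - x))%:E)%E.
Proof.
move=> xy; rewrite integral_cst//= lebesgue_measure_itv/= lte_fin.
case: ltP => [//|yx]; have -> : x = y by apply/le_anti; rewrite xy.
by rewrite subrr mulr0 mule0.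
Qed.

(** On []x, y]] the density [h t * S t] lies between [h x * S y] and [h y * S x]; integrating gives
    this bound and the next one. *)
Lemma survival_increment_ge x y : x <= y -> 0 < S y ->
  h x * S y * (y - x) <= S x - S y.
Proof.
move=> xy Sy; have -> : S x - S y = F y - F x by rewrite /S; ring.
rewrite -lee_fin cdf_increment// -integral_itv_cst//.
apply: ge0_le_integral => //=.
- by move=> t _; rewrite lee_fin mulr_ge0 ?hazard_rate_ge0// ltW.
- by apply/measurable_EFinP; exact: measurable_funTS.
move=> t; rewrite in_itv/= => /andP[xt ty]; rewrite lee_fin.
have FtFy := cdf_nondecreasing_density ty.
have St : 0 < S t by move: Sy; rewrite /S; lra.
have FxFt := cdf_nondecreasing_density (ltW xt).
rewrite densityE// ler_pM ?hazard_rate_ge0 ?(ltW Sy)//.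
  by apply: h_nondecr; [move: St; rewrite /S; lra|move: St; rewrite /S;
    lra|exact: ltW].
by rewrite /S; lra.
Qed.

Lemma survival_increment_le x y : x <= y -> 0 < S y ->
  S x - S y <= h y * S x * (y - x).
Proof.
move=> xy Sy; have -> : S x - S y = F y - F x by rewrite /S; ring.
rewrite -lee_fin cdf_increment// -integral_itv_cst//.
apply: ge0_le_integral => //=.
- by move=> t _; rewrite lee_fin.
- by apply/measurable_EFinP; exact: measurable_funTS.
move=> t; rewrite in_itv/= => /andP[xt ty]; rewrite lee_fin.
have FtFy := cdf_nondecreasing_density ty.
have St : 0 < S t by move: Sy; rewrite /S; lra.
have FxFt := cdf_nondecreasing_density (ltW xt).
rewrite densityE// ler_pM ?hazard_rate_ge0 ?(ltW St)//.
  by apply: h_nondecr; [move: St; rewrite /S; lra|move: Sy; rewrite /S; lra|].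
by rewrite /S; lra.
Qed.

(* the hazard rate enters only through these two properties of the conditional
   survival function [S (x + t) / S x] *)
Lemma conditional_survival_le x t : 0 <= t ->
  S (x + t) / S x <= expR (- (h x * t)).
Proof.
move=> t0; have Sge0 z : 0 <= S z by rewrite subr_ge0.
have [Sx0|Sx0] := ltP 0 (S x); last first.
  have -> : S x = 0 by apply/le_anti; rewrite Sx0 Sge0.
  by rewrite invr0 mulr0 expR_ge0.
rewrite ler_pdivrMr// mulrC -{2}(addrK x t) [t + x]addrC.
apply: (@survival_exp_le R S h) => //.
- by move=> a b /cdf_nondecreasing_density; rewrite /S; lra.
- by move=> a _; exact: hazard_rate_ge0.
- move=> a b Sb ab; have := cdf_nondecreasing_density ab => Fab.
  by apply: h_nondecr => //; move: Sb; rewrite /S; lra.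
- exact: survival_increment_ge.
- exact: survival_increment_le.
- by rewrite lerDl.
Qed.

Lemma conditional_survival_nincr x y t : 0 <= t -> x <= y ->
  S (y + t) / S y <= S (x + t) / S x.
Proof.
move=> t0 xy; have Sge0 z : 0 <= S z by rewrite subr_ge0.
have Fxy := cdf_nondecreasing_density xy.
have [Sy0|Sy0] := ltP 0 (S y); last first.
  have -> : S y = 0 by apply/le_anti; rewrite Sy0 Sge0.
  by rewrite invr0 mulr0 divr_ge0.
have Sx0 : 0 < S x by move: Sy0; rewrite /S; lra.
rewrite ler_pdivrMr// mulrAC ler_pdivlMr//.
apply: (@survival_log_concave R S h) => //.
- by move=> a b /cdf_nondecreasing_density; rewrite /S; lra.
- by move=> a _; exact: hazard_rate_ge0.
- move=> a b Sb ab; have := cdf_nondecreasing_density ab => Fab.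
  by apply: h_nondecr => //; move: Sb; rewrite /S; lra.
- exact: survival_increment_ge.
- exact: survival_increment_le.
Qed.

End bounds.
End density.

(** * The conditional law of a gap *)

Lemma Rintegral_bool {R : realType} {d} {T : measurableType d} (P : probability T R)
    (b : T -> bool) : measurable [set w | b w] ->
  \int[P]_w (b w)%:R = fine (P [set w | b w]).
Proof.
move=> mb; rewrite /Rintegral; congr fine.
rewrite -(setIT [set w | b w]) -integral_indic//.
apply: eq_integral => w _; congr EFin; rewrite indicE.
by have -> : (w \in [set w | b w]) = b w by apply/idP/idP; rewrite inE.
Qed.

Section gaps.
Context {R : realType} {d : measure_display} {T : measurableType d}.
Context {P : probability T R} {n : nat}.
Variables (X : 'I_n -> {RV P >-> R}) (F f : R -> R).
Hypothesis indepX : mutually_independent X.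
Hypothesis cdfX : forall (i : 'I_n) (x : R), cdf (X i) x = (F x)%:E.
Hypothesis densF : is_density_of f F.
Variable k : nat.
Hypotheses (k_gt0 : (0 < k)%N) (k_lt_n : (k < n)%N).
Local Notation full := (finset.setTfor 'I_n : {set 'I_n}).
Local Notation Z := (order_stat (fun i => X i : T -> R) k).
Local Notation Y := (order_stat (fun i => X i : T -> R) k.+1).
Let S x := 1 - F x.

Let n_gt0 : (0 < n)%N. Proof. exact: leq_ltn_trans k_lt_n. Qed.

Lemma prob_le i x : P (X i @^-1` `]-oo, x]) = (F x)%:E.
Proof. exact: (cdfX i x). Qed.

Lemma cdf_ge0_le1 x : 0 <= F x <= 1.
Proof.
rewrite -!lee_fin -(cdfX (Ordinal n_gt0)).
by rewrite cdf_ge0 cdf_le1.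
Qed.

Let mX i (B : set R) : measurable B -> measurable (X i @^-1` B).
Proof. by move=> mB; rewrite -[X in measurable X]setTI;
  exact: measurable_funPT. Qed.

Lemma prob_gt i x : P (X i @^-1` `]x, +oo[) = (S x)%:E.
Proof.
have -> : X i @^-1` `]x, +oo[ = ~` (X i @^-1` `]-oo, x]).
  by rewrite preimage_setC setCitvl.
by rewrite probability_setC ?prob_le//; exact: mX.
Qed.

Lemma prob_eq i x : P (X i @^-1` [set x]) = 0%E.
Proof.
apply/eqP; rewrite -measure_le0; apply/lee_addgt0Pr => e e0; rewrite add0e.
have [y [yx Fy]] : exists y, y < x /\ F x - F y <= e.
  have /cvgrPdist_le/(_ e e0) cv := cdf_cvg_left densF (x := x).
  have : \forall y \near x^'-, y < x /\ `|F x - F y| <= e.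
    by apply: filterS2 (nbhs_left_lt x) cv => y.
  move=> /filter_ex[y [yx h]].
  by exists y; split => //; exact: le_trans (ler_norm _) h.
apply: (@le_trans _ _ (P (X i @^-1` `]y, x]))).
  apply: le_measure; rewrite ?inE; [exact: mX|exact: mX|].
  by move=> w /= ->; rewrite in_itv/= yx lexx.
have -> : X i @^-1` `]y, x] = (X i @^-1` `]-oo, x]) `\` (X i @^-1` `]-oo, y]).
  apply/seteqP; split => w /=; rewrite !in_itv/=.
    by move=> /andP[yX ->]; split => //; apply/negP; rewrite -ltNge.
  by move=> [-> /negP]; rewrite -ltNge => ->.
rewrite measureD; [|exact: mX|exact: mX|by rewrite ltey_eq fin_num_measure//;
  exact: mX].
rewrite setIidr; last first.
  by move=> w /=; rewrite !in_itv/= => /le_trans; apply; exact: ltW.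
change (P (X i @^-1` `]-oo, x]) - P (X i @^-1` `]-oo, y]) <= e%:E)%E.
by rewrite !prob_le -EFinB lee_fin.
Qed.

Let F_le x y : x <= y -> F x <= F y.
Proof. exact: (cdf_nondecreasing_density densF). Qed.

Let mF : measurable_fun [set: R] F.
Proof. by apply: nondecreasing_measurable => // x y; exact: F_le. Qed.

Let mS t : measurable_fun [set: R] (fun x => S (x + t)).
Proof.
apply: measurable_funB => //; apply: (measurableT_comp mF).
exact: measurable_funD.
Qed.

Let mtnth (i : 'I_n) : measurable_fun [set: n.-tuple R] (fun x => tnth x i).
Proof. exact: measurable_tnth. Qed.

Lemma prob_tie i j : i != j -> P [set w | X i w = X j w] = 0%E.
Proof.
move=> ij.
have meq : measurable_fun [set: n.-tuple R] (fun x => tnth x i == tnth x j).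
  exact: measurable_fun_eqr.
have bt := @bounded_measurable_bool R _ _ _ meq.
have mE : measurable [set w | X i w == X j w].
  have := measurable_fun_eqr (@measurable_funPT _ _ _ _ (X i))
    (@measurable_funPT _ _ _ _ (X j)).
  by move=> /(_ measurableT [set true]); rewrite setTI; apply.
have -> : [set w | X i w = X j w] = [set w | X i w == X j w].
  by apply/seteqP; split => w /= /eqP.
rewrite -[LHS]fineK ?fin_num_measure// -Rintegral_bool//; congr EFin.
have -> : \int[P]_w (X i w == X j w)%:R =
    \int[P]_w (tnth (sample X w) i == tnth (sample X w) j)%:R :> R.
  by apply: eq_Rintegral => w _; rewrite !tnth_sample.
(* With coordinate [i] resampled and [X j] frozen, a tie means that [X i] hits a given point. *)
rewrite (resample indepX i bt) -[RHS](Rintegral_probability_cst P).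
apply: eq_Rintegral => w _; rewrite /partial_int.
have ji : j == i = false by rewrite eq_sym (negbTE ij).
under eq_Rintegral do rewrite !tnth_upd eqxx ji tnth_sample.
have E : [set v | X i v == X j w] = X i @^-1` [set X j w].
  by apply/seteqP; split => v /= /eqP.
by rewrite Rintegral_bool E ?prob_eq//; exact: mX.
Qed.

Lemma ae_injective : {ae P, forall w, injective (X ^~ w)}.
Proof.
pose N := \big[setU/set0]_(p : 'I_n * 'I_n | p.1 != p.2) [set w | X p.1 w =
  X p.2 w].
apply: (@negligibleS _ _ _ P N).
  move=> w /= ninj; apply: contrapT => Nw; apply: ninj => i j Xij.
  apply/eqP; apply: contrapT => /negP ij; apply: Nw.
  by rewrite /N (bigD1 (i, j))//=; left.
rewrite /N; apply: big_ind => [|A B|p ij]; first exact: negligible_set0.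
  exact: negligibleU.
apply/negligibleP; last exact: prob_tie.
have := measurable_fun_eqr (@measurable_funPT _ _ _ _ (X p.1))
  (@measurable_funPT _ _ _ _ (X p.2)).
move=> /(_ measurableT [set true]); rewrite setTI.
have -> : [set w | X p.1 w = X p.2 w] = [set w | X p.1 w == X p.2 w].
  by apply/seteqP; split => w /= /eqP.
by apply.
Qed.

(** Probability that the indices neither equal to [p.1] nor in [p.2] stay at or below [x]. It does
    not involve [t], hence is common to the cells for [t] and for [0]. *)
Let spectators (p : 'I_n * {set 'I_n}) x :=
  \prod_(i in [set~ p.1]%SET | i \notin p.2) F x.

Let cell_prob t (p : 'I_n * {set 'I_n}) x : #|p.2| = k -> p.1 \notin p.2 ->
  \int[P]_w (gap_config (tnth (upd (sample X w) p.1 x)) t p)%:R =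
  S (x + t) ^+ k * spectators p x.
Proof.
case: p => j A /= cA jA.
pose B i := if i \in A then `]x + t, +oo[%classic else `]-oo, x]%classic.
have mB i : measurable (B i) by rewrite /B; case: ifP.
have E : [set w | gap_config (tnth (upd (sample X w) j x)) t (j, A)] =
    \bigcap_(i in [set` [set~ j]%SET]) (X i @^-1` B i).
  apply/seteqP; split => w /=.
    move=> /andP[/forall_inP/= h1 /forall_inP/= h2] i /=;
      rewrite finset.in_setC1 => ij.
    rewrite /B; case: (boolP (i \in A)) => iA; rewrite /= in_itv/=.
      by have := h1 i iA; rewrite !tnth_upd eqxx (negbTE ij) tnth_sample andbT.
    have := h2 i; rewrite !finset.inE negb_or ij iA => /(_ isT).
    by rewrite !tnth_upd eqxx (negbTE ij) tnth_sample.
  move=> h; apply/andP; split; apply/forall_inP => i /=.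
    move=> iA; have ij : i != j by apply: contraNneq jA => <-.
    have := h i; rewrite /= finset.in_setC1 => /(_ ij).
    by rewrite /B iA /= in_itv/= andbT !tnth_upd eqxx (negbTE ij) tnth_sample.
  rewrite !finset.inE negb_or => /andP[ij iA].
  have := h i; rewrite /= finset.in_setC1 => /(_ ij).
  by rewrite /B (negbTE iA) /= in_itv/= !tnth_upd eqxx (negbTE ij) tnth_sample.
rewrite Rintegral_bool E; last first.
  apply: fin_bigcap_measurable => [|i _]; first exact: finite_finset.
  exact: mX.
rewrite indepX//.
have -> : (\prod_(i in [set~ j]%SET) P (X i @^-1` B i))%E =
    (\prod_(i in [set~ j]%SET) (if i \in A then S (x + t) else F x))%:E.
  rewrite -prodEFin; apply: eq_bigr => i _; rewrite /B.
  by case: ifP => _; rewrite ?prob_gt ?prob_le.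
rewrite /= (bigID (mem A))/=; congr (_ * _).
  rewrite -cA -prodr_const; apply: congr_big => // i.
    rewrite finset.in_setC1 andbC; case: (boolP (i \in A)) => //= iA.
    by apply: contraNneq jA => <-.
  by move=> /andP[_ ->].
by apply: eq_bigr => i /andP[_ /negbTE ->].
Qed.

Let bounded_config t p (g : R -> R) : bounded_measurable g ->
  bounded_measurable (fun x : n.-tuple R => (gap_config (tnth x) t p)%:R * g (tnth
    x p.1)).
Proof.
move=> bg; apply: bounded_measurableM; last exact: bounded_measurable_comp.
apply: bounded_measurable_bool.
have mforall (Q : pred 'I_n) (b : 'I_n -> n.-tuple R -> bool) :
    (forall i, measurable_fun [set: n.-tuple R] (b i)) ->
    measurable_fun [set: n.-tuple R] (fun x => [forall i in Q, b i x]).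
  move=> mb; apply: (measurable_fun_bool true); rewrite setTI.
  rewrite (_ : _ @^-1` _ = \bigcap_(i in [set i | Q i]) (b i @^-1` [set true])).
    apply: fin_bigcap_measurable => [|i _]; first exact: finite_finset.
    by rewrite -[X in measurable X]setTI; exact: mb.
  apply/seteqP; split => x /=; first by move=> /forall_inP h i Qi; exact: h.
  by move=> h; apply/forall_inP => i Qi; exact: h.
apply: measurable_and; apply: mforall => i.
  by apply: measurable_fun_ltr => //; exact: measurable_funD.
exact: measurable_fun_ler.
Qed.

(** Ties being negligible, the indicator of the event is a sum of configuration indicators. In each
    cell, resampling the index of X_(k+1) separates its value from the other coordinates. *)
Lemma gap_law t (g : R -> R) : 0 <= t -> bounded_measurable g ->
  \int[P]_w ((t < Z w - Y w)%R%:R * g (Y w)) =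
  \sum_(p : 'I_n * {set 'I_n} | (#|p.2| == k) && (p.1 \notin p.2))
    \int[P]_w (g (X p.1 w) * (S (X p.1 w + t) ^+ k * spectators p (X p.1 w))).
Proof.
move=> t0 bg.
have bZY : bounded_measurable (fun w => (t < Z w - Y w)%R%:R * g (Y w)).
  have mZ : measurable_fun [set: T] Z.
    by apply: measurable_order_stat; rewrite k_gt0 ltnW.
  have mY : measurable_fun [set: T] Y by exact: measurable_order_stat.
  apply: bounded_measurableM; last exact: bounded_measurable_comp.
  apply: bounded_measurable_bool; apply: measurable_fun_ltr => //.
  exact: measurable_funB.
have bcfg p := bounded_measurable_comp (measurable_sample X)
  (bounded_config t p bg).
have bsum := bounded_measurable_sum (index_enum _)
  (fun p : 'I_n * {set 'I_n} => (#|p.2| == k) && (p.1 \notin p.2)) bcfg.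
have -> : \int[P]_w ((t < Z w - Y w)%R%:R * g (Y w)) =
    \int[P]_w \sum_(p : 'I_n * {set 'I_n} | (#|p.2| == k) && (p.1 \notin p.2))
      (gap_config (tnth (sample X w)) t p)%:R * g (tnth (sample X w) p.1).
  rewrite /Rintegral; congr fine; apply: ae_eq_integral => //.
  - by apply/measurable_EFinP; case: bZY.
  - by apply/measurable_EFinP; case: bsum.
  apply: filterS ae_injective => w inj _.
  have e : tnth (sample X w) = X ^~ w by apply/funext => i; rewrite tnth_sample.
  by rewrite e /= (sum_gap_config k_gt0 k_lt_n)// !order_stat_sub.
rewrite (Rintegral_sum _ _ _ bcfg); apply: eq_bigr => p /andP[/eqP cp jp].
rewrite (resample indepX p.1 (bounded_config t p bg)) /partial_int.
have bU : bounded_measurable (fun q : T * T =>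
    (gap_config (tnth (upd (sample X q.1) p.1 (X p.1 q.2))) t p)%:R *
    g (tnth (upd (sample X q.1) p.1 (X p.1 q.2)) p.1)).
  apply: (bounded_measurable_comp (f :=
    fun q : T * T => upd (sample X q.1) p.1 (X p.1 q.2)) _
    (bounded_config t p bg)).
  apply: measurable_upd; first by apply: measurableT_comp => //;
    exact: measurable_sample.
  exact: measurableT_comp.
(* After the exchange the value of [X p.1] is frozen in the inner integral, which is then a cell
   probability. *)
rewrite (Rintegral_swap P P bU); apply: eq_Rintegral => w _.
rewrite -(cell_prob t (X p.1 w) cp jp) -RintegralZl//.
  by apply: eq_Rintegral => v _; rewrite tnth_upd eqxx mulrC.
apply: bounded_measurable_integrable.
have bc := bounded_config t p (bounded_measurable_cst (1 : R)).
have mu : measurable_fun [set: T] (fun v => upd (sample X v) p.1 (X p.1 w)).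
  by apply: measurable_upd; [exact: measurable_sample|exact: measurable_cst].
have := bounded_measurable_comp mu bc.
by under eq_fun do rewrite /= mulr1.
Qed.

(** Since [0^-1 = 0] and [k] is positive, this is [0] wherever [S x = 0], so it keeps values in
    [0, 1] and stays monotone beyond the right end of the support. *)
Definition conditional_survival t x : R := (S (x + t) / S x) ^+ k.

Lemma conditional_survival_range t x : 0 <= t -> 0 <= conditional_survival t x <= 1.
Proof.
move=> t0; have Sge0 z : 0 <= S z by have := cdf_ge0_le1 z; rewrite /S; lra.
have r0 : 0 <= S (x + t) / S x by rewrite divr_ge0.
have r1 : S (x + t) / S x <= 1.
  have [Sx0|Sx0] := ltP 0 (S x); last first.
    have -> : S x = 0 by apply/le_anti; rewrite Sx0 Sge0.
    by rewrite invr0 mulr0.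
  rewrite ler_pdivrMr// mul1r; have := F_le (x := x) (y := x + t).
  by rewrite lerDl => /(_ t0); rewrite /S; lra.
by rewrite exprn_ge0// exprn_ile1.
Qed.

Lemma measurable_conditional_survival t :
  measurable_fun [set: R] (conditional_survival t).
Proof.
apply: measurable_funX; apply: measurable_funM => //.
have Sge0 z : 0 <= S z by have := cdf_ge0_le1 z; rewrite /S; lra.
by apply: measurable_fun_inv => //; exact: measurable_funB.
Qed.

(** [gap_law] is applied at [t] to [g] and at [0] to [conditional_survival t] times [g]; the two
    sums agree term by term. *)
Lemma gap_conditional t (g : R -> R) : 0 <= t -> bounded_measurable g ->
  \int[P]_w ((t < Z w - Y w)%R%:R * g (Y w)) =
  \int[P]_w (conditional_survival t (Y w) * g (Y w)).
Proof.
move=> t0 bg; rewrite gap_law//.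
have ba : bounded_measurable (conditional_survival t).
  apply: (@bounded_measurable_range _ _ _ 0 1).
    exact: measurable_conditional_survival.
  by move=> x; exact: conditional_survival_range.
have bag := bounded_measurableM ba bg.
transitivity (\int[P]_w ((0 < Z w - Y w)%R%:R * (conditional_survival t (Y w) * g
  (Y w)))).
  rewrite (gap_law (lexx 0) bag); apply: eq_bigr => p _; apply: eq_Rintegral => w _.
  suff -> : S (X p.1 w + t) ^+ k =
    conditional_survival t (X p.1 w) * S (X p.1 w) ^+ k.
    by rewrite addr0; ring.
  rewrite /conditional_survival -exprMn.
  have [Sx0|Sx0] := eqVneq (S (X p.1 w)) 0; last by rewrite divfK.
  rewrite Sx0 mulr0; congr (_ ^+ _); apply/le_anti.
  have := cdf_ge0_le1 (X p.1 w + t).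
  have := F_le (x := X p.1 w) (y := X p.1 w + t); rewrite lerDl => /(_ t0).
  move: Sx0; rewrite /S => h1 h2 /andP[h3 h4]; apply/andP; split; lra.
(* It remains to drop the indicator of a positive gap, which is almost surely [1]. *)
rewrite /Rintegral; congr fine; apply: ae_eq_integral => //.
- apply/measurable_EFinP; apply: measurable_funM; last first.
    apply: (@measurableT_comp _ _ _ _ _ _ (fun y => conditional_survival t y * g
      y)) => //.
      by case: bag.
    exact: measurable_order_stat.
  have mZ : measurable_fun [set: T] Z.
    by apply: measurable_order_stat; rewrite k_gt0 ltnW.
  have mY : measurable_fun [set: T] Y by exact: measurable_order_stat.
  have := @bounded_measurable_bool R _ _ (fun w => 0 < Z w - Y w) _.
  by case=> //; apply: measurable_fun_ltr => //; exact: measurable_funB.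
- apply/measurable_EFinP.
  apply: (@measurableT_comp _ _ _ _ _ _ (fun y => conditional_survival t y * g y))
    => //.
    by case: bag.
  exact: measurable_order_stat.
apply: filterS ae_injective => w inj _.
rewrite subr_gt0 /= !order_stat_sub (lt_consecutive k_gt0 k_lt_n inj) ?mul1r//.
Qed.

End gaps.

(** * Layer-cake formula *)

Section layer_cake.
Context {R : realType}.
Local Notation mu := (@lebesgue_measure R).
Variables G g : R -> R.
Hypothesis dG : forall x : R, is_derive x 1 G (g x).
Hypothesis cg : continuous g.
Hypothesis G0 : G 0 = 0.
Hypothesis g_ge0 : forall t, 0 <= t -> 0 <= g t.

Let cG : continuous G.
Proof. by move=> y; apply/differentiable_continuous/derivable1_diffP;
  case: (dG y). Qed.

(** The domain is encoded by indicators on the whole line, so that the integrand becomes a function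
    on a product space when [x] is random and Tonelli's theorem applies. *)
Lemma layer_cake x : 0 <= x ->
  ((G x)%:E = \int[mu]_t ((0 <= t)%R%:R * ((t < x)%R%:R * g t))%:E)%E.
Proof.
move=> x0; transitivity (\int[mu]_(t in `[0%R, x[) (g t)%:E)%E; last first.
  rewrite integral_mkcond; apply: eq_integral => t _.
  rewrite patchE mem_setE in_itv/=.
  by case: (0 <= t); case: (t < x); rewrite ?(mul1r, mul0r).
rewrite integral_itv_bndo_bndc; last first.
  by apply/measurable_EFinP; apply: measurable_funTS;
    exact: continuous_measurable_fun.
move: x0; rewrite le_eqVlt => /predU1P[<-|x0].
  by rewrite set_itv1 integral_set1 G0.
rewrite (@continuous_FTC2 _ g G)// ?G0 ?sube0//.
- exact: continuous_subspaceT.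
- split; first by move=> z _; case: (dG z).
    by apply: cvg_at_right_filter; exact: cG.
  by apply: cvg_at_left_filter; exact: cG.
- by move=> z _; rewrite derive1E (@derive_val _ _ _ _ _ _ _ (dG z)).
Qed.

Context {d : measure_display} {T : measurableType d}.
Variable P : probability T R.

Lemma layer_cake_expectation (W D : T -> R) : bounded_measurable W ->
  (forall w, 0 <= W w) ->
  measurable_fun [set: T] D -> (forall w, 0 <= D w) ->
  (\int[P]_w (W w * G (D w))%:E =
   \int[mu]_t ((0 <= t)%R%:R * g t * \int[P]_w ((t < D w)%R%:R * W w))%:E)%E.
Proof.
move=> bW W0 mD D0; have mW : measurable_fun [set: T] W by case: bW.
pose H (q : T * measurableTypeR R) : \bar R :=
  ((0 <= q.2)%R%:R * g q.2 * ((q.2 < D q.1)%R%:R * W q.1))%:E.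
have mg : measurable_fun [set: R] g by exact: continuous_measurable_fun.
have mb (b : T * measurableTypeR R ->
  bool) : measurable_fun [set: T * measurableTypeR R] b ->
    measurable_fun [set: T * measurableTypeR R] (fun q => (b q)%:R : R).
  by move=> mb; case: (@bounded_measurable_bool R _ _ b mb).
have mb1 (b : measurableTypeR R ->
  bool) : measurable_fun [set: measurableTypeR R] b ->
    measurable_fun [set: measurableTypeR R] (fun t => (b t)%:R : R).
  by move=> mb1; case: (@bounded_measurable_bool R _ _ b mb1).
have m2 : measurable_fun [set: T * measurableTypeR R] (snd : _ ->
  R) by exact: measurable_snd.
have mDfst : measurable_fun [set: T * measurableTypeR R] (fun q => D q.1).
  by apply: (measurableT_comp mD); exact: measurable_fst.
have mH : measurable_fun [set: T * measurableTypeR R] H.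
  apply/measurable_EFinP; apply: measurable_funM; apply: measurable_funM.
  - by apply: mb; exact: measurable_fun_ler.
  - exact: (measurableT_comp mg).
  - by apply: mb; exact: measurable_fun_ltr.
  - by apply: (measurableT_comp mW); exact: measurable_fst.
have H0 q : (0 <= H q)%E.
  rewrite lee_fin; case: (leP 0 q.2) => [q0|]; last by rewrite !mul0r.
  by rewrite mul1r !mulr_ge0 ?g_ge0.
have := @fubini_tonelli _ _ T (measurableTypeR R) R P mu H mH H0.
have bI t : bounded_measurable (fun w => (t < D w)%R%:R * W w).
  apply: bounded_measurableM => //; apply: bounded_measurable_bool.
  exact: measurable_fun_ltr.
rewrite (_ : (\int[P]_x \int[mu]_y H (x, y) = \int[P]_w (W w * G (D w))%:E)%E);
  last first.
  apply: eq_integral => w _; rewrite EFinM layer_cake// -ge0_integralZl//.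
  - by apply: eq_integral => t _; rewrite -EFinM; congr EFin => /=; ring.
  - apply/measurable_EFinP; apply: measurable_funM;
    last apply: measurable_funM => //.
    + by apply: mb1; exact: measurable_fun_ler.
    + by apply: mb1; exact: measurable_fun_ltr.
  - move=> t _; rewrite lee_fin; case: (leP 0 t) => [t0|]; last by rewrite mul0r.
    by rewrite mul1r mulr_ge0 ?g_ge0.
  - by rewrite lee_fin.
move=> ->; apply: eq_integral => t _; rewrite EFinM EFin_Rintegral//.
rewrite -ge0_integralZl//.
- by apply/measurable_EFinP; case: (bI t).
- by move=> w _; rewrite lee_fin mulr_ge0.
- rewrite lee_fin; case: (leP 0 t) => [t0|]; last by rewrite mul0r.
  by rewrite mul1r g_ge0.
Qed.

End layer_cake.

(** * Second moment of the exponential law *)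

Section exponential_second_moment.
Context {R : realType}.
Local Notation mu := (@lebesgue_measure R).

Lemma integral_exponential_second_moment (a : R) : 0 < a ->
  (\int[mu]_t ((0 <= t)%R%:R * (2 * t) * expR (- (a * t)))%:E = (2 / a ^+ 2)%:E)%E.
Proof.
move=> a0.
pose f t := 2 * t * expR (- (a * t)).
pose G t := - (2 / a ^+ 2) * ((1 + a * t) * expR (- (a * t))).
have de (t : R) : is_derive t 1 (fun t => expR (- (a * t)))
  (- a * expR (- (a * t))).
  have h := @is_derive1_comp _ expR (fun t => - (a * t)) t _ _ (is_derive_expR _)
    (is_deriveN (is_deriveZ a (is_derive_id t 1))).
  by apply: (is_derive_eq h); rewrite /GRing.scale/=; ring.
have dG (t : R) : is_derive t 1 G (f t).
  have h := is_deriveZ (- (2 / a ^+ 2))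
    (is_deriveM (is_deriveD (is_derive_cst (1 : R) t 1)
    (is_deriveZ a (is_derive_id t 1))) (de t)).
  apply: (is_derive_eq h); rewrite /GRing.scale/= /f !fctE/= /GRing.scale/=; field.
  by rewrite gt_eqF.
have cG : continuous G.
  by move=> y; apply/differentiable_continuous/derivable1_diffP; case: (dG y).
have cf : continuous f.
  move=> t; apply: continuousM.
    by apply: continuousM => //; exact: cvg_cst.
  by apply/differentiable_continuous/derivable1_diffP; case: (de t).
have Gy : G t @[t --> +oo] --> 0.
  rewrite -(mulr0 (- (2 / a ^+ 2))); apply: cvgM; first exact: cvg_cst.
  (* With [s = a / 2 * t], half of the exponential absorbs the linear factor:
     [1 + 2 * s <= 2 * expR s]. *)
  apply: (@squeeze_cvgr _ _ _ _ (cst 0) (fun t => 2 * expR (- (a / 2 * t)))).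
  - near=> t.
    have t0 : 0 <= t by near: t; exact: nbhs_pinfty_ge.
    have at0 : 0 <= a * t by rewrite mulr_ge0// ltW.
    rewrite mulr_ge0 ?expR_ge0 ?addr_ge0//=.
    have -> : - (a * t) = - (a / 2 * t) + - (a / 2 * t) by field.
    rewrite expRD mulrA ler_wpM2r ?expR_ge0//.
    have -> : 1 + a * t = 1 + 2 * (a / 2 * t) by field.
    have := expR_ge1Dx (a / 2 * t); have := expR_gt0 (- (a / 2 * t)).
    have : expR (a / 2 * t) * expR (- (a / 2 * t)) =
      1 by rewrite -expRD subrr expR0.
    have : 0 <= a / 2 * t by rewrite mulr_ge0// divr_ge0// ltW.
    by nra.
  - exact: cvg_cst.
  - rewrite -(mulr0 2); apply: cvgM; first exact: cvg_cst.
    apply: (@cvg_comp _ _ _ (fun t : R => a / 2 * t) (fun x => expR (- x)) _ +oo);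
      last exact: cvgr_expR.
    by apply: gt0_cvgMry; [rewrite divr_gt0|exact: cvg_id].
transitivity (\int[mu]_(t in `[0%R, +oo[) (f t)%:E)%E.
  rewrite [RHS]integral_mkcond; apply: eq_integral => t _.
  rewrite patchE mem_setE in_itv/= andbT.
  by case: (0 <= t); rewrite /f ?(mul1r, mul0r).
rewrite (@ge0_continuous_FTC2y _ f G 0 0)//.
- by rewrite /G mulr0 oppr0 expR0 addr0 !mulr1 sub0e -EFinN opprK.
- by move=> t t0; rewrite mulr_ge0 ?expR_ge0// mulr_ge0.
- exact: continuous_subspaceT.
- by apply: cvg_at_right_filter; exact: cG.
- by move=> t _; rewrite derive1E (@derive_val _ _ _ _ _ _ _ (dG t)).
Unshelve. all: by end_near. Qed.

End exponential_second_moment.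

(** * Truncation and moments of gaps *)

Lemma limn_einf_le {R : realType} (u : (\bar R)^nat) (c : \bar R) :
  (forall n, (u n <= c)%E) -> (limn_einf u <= c)%E.
Proof.
move=> uc; rewrite limn_einf_lim; apply: lime_le; first exact: is_cvg_einfs.
apply: nearW => n; apply: le_trans (uc n).
by apply: ereal_inf_lbound; exists n => //=.
Qed.

Section truncation.
Context {R : realType} {d : measure_display} {T : measurableType d}.
Variables (P : probability T R) (Z : T -> R).
Hypothesis intZ : P.-integrable [set: T] (EFin \o Z).

Let mZ : measurable_fun [set: T] Z.
Proof. by apply/measurable_EFinP; case/integrableP: intZ. Qed.

Lemma measurable_clipped m : measurable_fun [set: T] (fun w => clip m (Z w)).
Proof. by apply: measurableT_comp => //; exact: measurable_clip. Qed.

Lemma clip_cvg (x : R) : clip n%:R x @[n --> \oo] --> x.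
Proof.
apply: cvg_near_cst; exists (Num.truncn `|x|).+1 => // n /= xn.
have : `|x| <= n%:R by rewrite (le_trans (ltW (truncnS_gt _)))// ler_nat.
rewrite ler_norml => /andP[a b]; rewrite /clip.
by rewrite (min_idPl b) (max_idPr a).
Qed.

Lemma norm_clip_le (n : nat) (x : R) : `|clip n%:R x| <= `|x|.
Proof.
have n0 : 0 <= n%:R :> R by [].
have [x0|x0] := leP 0 x.
  have /andP[a b] := clip_lipschitz n%:R x0.
  have c0 : clip n%:R 0 = 0 :> R.
    by rewrite /clip (min_idPl n0) (max_idPr _)// oppr_le0.
  by move: a b; rewrite c0 !subr0 => a b; rewrite !ger0_norm.
have /andP[a b] := clip_lipschitz n%:R (ltW x0).
have c0 : clip n%:R 0 = 0 :> R.
  by rewrite /clip (min_idPl n0) (max_idPr _)// oppr_le0.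
move: a b; rewrite c0 !sub0r => a b.
by rewrite (ltr0_norm x0) ler0_norm// -oppr_ge0.
Qed.

Lemma cvg_expectation_clip :
  \int[P]_w clip n%:R (Z w) @[n --> \oo] --> fine (\int[P]_w (Z w)%:E)%E.
Proof.
have mn n : measurable_fun [set: T] (EFin \o (fun w => clip n%:R (Z w))).
  by apply/measurable_EFinP; exact: measurable_clipped.
have intZ' : P.-integrable [set: T] (EFin \o (fun w => `|Z w|)).
  exact: (integrable_abse intZ).
have lim : {ae P, forall w, [set: T] w ->
    (clip n%:R (Z w))%:E @[n --> \oo] --> (EFin \o Z) w}.
  by apply: aeW => w _; apply: cvg_EFin; [exact: nearW|exact: clip_cvg].
have dom : {ae P, forall w (n : nat), [set: T] w ->
    (`|(clip n%:R (Z w))%:E| <= (EFin \o (fun w => `|Z w|)%R) w)%E}.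
  by apply: aeW => w n _; rewrite lee_fin norm_clip_le.
have [_ _ H] := dominated_convergence measurableT mn (measurable_int _ intZ) lim
  intZ' dom.
by apply: fine_cvg; rewrite fineK; last exact: integrable_fin_num.
Qed.

(** Used with a square for the variance and with an exponential for the Laplace transform. The
    clipped means converge by dominated convergence; the outer integrals need only Fatou's lemma, so
    no moment of [Psi] is presupposed. *)
Lemma centered_limit (Psi : R -> R) (c : \bar R) : continuous Psi ->
  (forall x, 0 <= Psi x) ->
  (forall n : nat, (\int[P]_w (Psi (clip n%:R (Z w) - \int[P]_v clip n%:R (Z
    v)))%:E <= c)%E) ->
  (\int[P]_w (Psi (Z w - fine (\int[P]_v (Z v)%:E)))%:E <= c)%E.
Proof.
move=> cPsi Psi0 h.
pose u n w := (Psi (clip n%:R (Z w) - \int[P]_v clip n%:R (Z v)))%:E.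
have lim w : u n w @[n --> \oo] --> (Psi (Z w - fine (\int[P]_v (Z v)%:E)))%:E.
  apply: cvg_EFin; first exact: nearW.
  apply: continuous_cvg; first exact: cPsi.
  by apply: cvgB; [exact: clip_cvg|exact: cvg_expectation_clip].
under eq_integral do rewrite -(cvg_limn_einf_sup (lim _)).1.
apply: (le_trans (fatou P measurableT _ _)).
- move=> n; apply/measurable_EFinP;
  apply: (measurableT_comp (continuous_measurable_fun cPsi)).
  by apply: measurable_funB => //; exact: measurable_clipped.
- by move=> n w _; rewrite lee_fin.
- exact: limn_einf_le.
Qed.

End truncation.

(** * Association and second moment of the spacing *)

Section gap_moments.
Context {R : realType} {d : measure_display} {T : measurableType d}.
Context {P : probability T R} {n : nat}.
Variables (X : 'I_n -> {RV P >-> R}) (F f : R -> R).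
Hypothesis indepX : mutually_independent X.
Hypothesis cdfX : forall (i : 'I_n) (x : R), cdf (X i) x = (F x)%:E.
Hypothesis densF : is_density_of f F.
Hypothesis h_nondecr : nondecreasing_hazard_rate F f.
Variable k : nat.
Hypotheses (k_gt0 : (0 < k)%N) (k_lt_n : (k < n)%N).
Local Notation Z := (order_stat (fun i => X i : T -> R) k).
Local Notation Y := (order_stat (fun i => X i : T -> R) k.+1).
Local Notation mu := (@lebesgue_measure R).

Let mZ : measurable_fun [set: T] Z.
Proof. by apply: measurable_order_stat; rewrite k_gt0 ltnW. Qed.
Let mY : measurable_fun [set: T] Y.
Proof. exact: measurable_order_stat. Qed.
Let mD : measurable_fun [set: T] (fun w => Z w - Y w).
Proof. exact: measurable_funB. Qed.
Let D_ge0 w : 0 <= Z w - Y w.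
Proof. by rewrite subr_ge0; exact: order_stat_le. Qed.
Let F_le1 x : F x <= 1.
Proof. by have /andP[] := cdf_ge0_le1 cdfX k_lt_n x. Qed.

Let a t x := conditional_survival F k t x.

Let bounded_a t : 0 <= t -> bounded_measurable (a t).
Proof.
move=> t0; apply: (@bounded_measurable_range _ _ _ 0 1).
  exact: (measurable_conditional_survival cdfX densF k_lt_n t).
by move=> x; exact: (conditional_survival_range cdfX densF k_lt_n x t0).
Qed.

(** The product [(b (Y w) - b (Y v)) * (g (Y w) - g (Y v))] is nonpositive; it is integrated over
    [w] and then over [v]. *)
Lemma Rintegral_Chebyshev_association (g b : R -> R) :
  bounded_measurable g -> bounded_measurable b ->
  (forall x y, x <= y -> g x <= g y) -> (forall x y, x <= y -> b y <= b x) ->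
  \int[P]_w (b (Y w) * g (Y w)) <= \int[P]_w b (Y w) * \int[P]_w g (Y w).
Proof.
move=> bg bb gle ble.
have bgY : bounded_measurable (fun w => g (Y w)) by exact: bounded_measurable_comp.
have bbY : bounded_measurable (fun w => b (Y w)) by exact: bounded_measurable_comp.
have bgb : bounded_measurable (fun w => b (Y w) * g (Y w)) by exact:
  bounded_measurableM.
have bc c : bounded_measurable (fun _ : T => c : R) by exact:
  bounded_measurable_cst.
have Eb := bounded_measurable_integrable P.
set Egb := \int[P]_w (b (Y w) * g (Y w)); set Eb' := \int[P]_w b (Y w);
  set Eg := \int[P]_w g (Y w).
have H v : Egb - Eb' * g (Y v) + b (Y v) * (g (Y v) - Eg) <= 0.
  have : \int[P]_w ((b (Y w) - b (Y v)) * (g (Y w) - g (Y v))) <= 0.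
    rewrite -[leRHS](Rintegral_probability_cst P);
      apply: le_Rintegral_bounded => //.
      by apply: bounded_measurableM; apply: bounded_measurableB.
    move=> w; case: (leP (Y w) (Y v)) => [|/ltW] wv.
      by rewrite mulr_ge0_le0 ?subr_ge0 ?subr_le0 ?ble ?gle.
    by rewrite mulr_le0_ge0 ?subr_ge0 ?subr_le0 ?ble ?gle.
  have -> : \int[P]_w ((b (Y w) - b (Y v)) * (g (Y w) - g (Y v))) =
      \int[P]_w ((b (Y w) * g (Y w) - b (Y w) * g (Y v)) + b (Y v) * (g (Y v) - g
        (Y w))).
    by apply: eq_Rintegral => w _; ring.
  have b1 : bounded_measurable (fun w => b (Y w) * g (Y v)) by exact:
    bounded_measurableM.
  have b2 : bounded_measurable (fun w => g (Y v) - g (Y w)) by exact: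
    bounded_measurableB.
  rewrite RintegralD ?RintegralB ?RintegralZl ?RintegralZr ?RintegralB
    ?Rintegral_probability_cst//;
    apply: Eb; by [|apply: bounded_measurableB|apply: bounded_measurableZ].
have : \int[P]_v (Egb - Eb' * g (Y v) + (b (Y v) * g (Y v) - b (Y v) * Eg)) <= 0.
  rewrite -[leRHS](Rintegral_probability_cst P); apply: le_Rintegral_bounded => //.
    apply: bounded_measurableD; apply: bounded_measurableB => //;
      exact: bounded_measurableM.
  by move=> v; rewrite -mulrBr; exact: H.
have b1 : bounded_measurable (fun w => Eb' * g (Y w)) by exact: bounded_measurableM.
have b2 : bounded_measurable (fun w => b (Y w) * Eg) by exact: bounded_measurableM.
rewrite RintegralD ?RintegralB ?RintegralZl ?RintegralZr
  ?Rintegral_probability_cst//;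
  try by apply: Eb; by [|apply: bounded_measurableB].
rewrite -/Egb -/Eb' -/Eg; lra.
Qed.

Let a_nincr t x y : 0 <= t -> x <= y -> a t y <= a t x.
Proof.
move=> t0 xy; rewrite /a /conditional_survival.
have Sge0 z : 0 <= 1 - F z by rewrite subr_ge0.
by rewrite lerXn2r ?nnegrE ?divr_ge0// (conditional_survival_nincr densF F_le1
  h_nondecr).
Qed.

Let a_le_exp t x : 0 <= t -> a t x <= expR (- (k%:R * hazard_rate F f x * t)).
Proof.
move=> t0; rewrite -mulrA -mulrN expRM_natl /a /conditional_survival.
have Sge0 z : 0 <= 1 - F z by rewrite subr_ge0.
rewrite lerXn2r ?nnegrE ?divr_ge0 ?expR_ge0//.
exact: (conditional_survival_le densF F_le1 h_nondecr).
Qed.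

Let bounded_survival (W : T -> R) : bounded_measurable W ->
  bounded_measurable (fun q : measurableTypeR R * T => (q.1 < Z q.2 - Y q.2)%R%:R
    * W q.2).
Proof.
move=> bW; apply: bounded_measurableM; last exact: bounded_measurable_comp.
apply: bounded_measurable_bool; apply: measurable_fun_ltr;
  first exact: measurable_fst.
by apply: (measurableT_comp mD); exact: measurable_snd.
Qed.

Let measurable_tail (G g : R -> R) (c : R) : continuous g ->
  measurable_fun [set: measurableTypeR R] (fun t : R => ((0 <= t)%R%:R * g t *
    (c * \int[P]_w ((t < Z w - Y w)%R%:R * 1)))%:E).
Proof.
move=> cg; apply/measurable_EFinP; apply: measurable_funM.
  apply: measurable_funM; last exact: continuous_measurable_fun.
  have : measurable_fun [set: measurableTypeR R] (fun t : R => 0 <=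
    t) by exact: measurable_fun_ler.
  by move=> mb; case: (@bounded_measurable_bool R _ _ _ mb).
apply: measurable_funM => //.
by case: (bounded_measurable_Rintegral P (bounded_survival (bounded_measurable_cst
  (1 : R)))).
Qed.

Section weighted.
Variables G g : R -> R.
Hypothesis dG : forall x : R, is_derive x 1 G (g x).
Hypothesis cg : continuous g.
Hypothesis G0 : G 0 = 0.
Hypothesis g_ge0 : forall t, 0 <= t -> 0 <= g t.

(* The conditional law of [Z - Y] given [Y] is stochastically decreasing in [Y]. *)
Lemma integral_gap_association (phi : R -> R) : bounded_measurable phi ->
  (forall x, 0 <= phi x) -> (forall x y, x <= y -> phi x <= phi y) ->
  (\int[P]_w (phi (Y w) * G (Z w - Y w))%:E <=
   (\int[P]_w phi (Y w))%:E * \int[P]_w (G (Z w - Y w))%:E)%E.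
Proof.
move=> bphi phi0 phile.
have bphiY : bounded_measurable (fun w => phi (Y w)) by exact:
  bounded_measurable_comp.
have E0 : 0 <= \int[P]_w phi (Y w) by apply: Rintegral_ge0.
rewrite (layer_cake_expectation dG cg G0 g_ge0 P bphiY _ mD)//.
have -> : (\int[P]_w (G (Z w - Y w))%:E = \int[P]_w (1 * G (Z w - Y w))%:E)%E.
  by apply: eq_integral => w _; rewrite mul1r.
have m1 := @measurable_tail G g 1 cg.
have tail0 (t : R) : 0 <= (0 <= t)%R%:R * g t.
  by case: (leP 0 t) => [t0|]; [rewrite mul1r g_ge0|rewrite mul0r].
rewrite (layer_cake_expectation dG cg G0 g_ge0 P (bounded_measurable_cst (1 : R))
  _ mD)//.
rewrite -ge0_integralZl//; last 2 first.
- by under eq_fun do rewrite -[X in _ * X]mul1r.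
- by move=> t _; rewrite lee_fin mulr_ge0//; apply: Rintegral_ge0 => w _;
  rewrite mulr1.
apply: ge0_le_integral => //.
- move=> t _; rewrite lee_fin mulr_ge0//; apply: Rintegral_ge0 => w _.
  by rewrite mulr_ge0.
- apply/measurable_EFinP; apply: measurable_funM; last first.
    by case: (bounded_measurable_Rintegral P (bounded_survival bphiY)).
  apply: measurable_funM; last exact: continuous_measurable_fun.
  have : measurable_fun [set: measurableTypeR R] (fun t : R => 0 <=
    t) by exact: measurable_fun_ler.
  by move=> mb; case: (@bounded_measurable_bool R _ _ _ mb).
- apply: emeasurable_funM => //.
  by under eq_fun do rewrite -[X in _ * X]mul1r.
move=> t _; rewrite -EFinM lee_fin [leRHS]mulrCA.
have [t0|t0] := leP 0 t; last by rewrite !mul0r.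
rewrite ler_wpM2l// ?mul1r ?g_ge0//.
rewrite (gap_conditional indepX cdfX densF k_gt0 k_lt_n t0 bphi).
rewrite (gap_conditional indepX cdfX densF k_gt0 k_lt_n t0 (bounded_measurable_cst
  (1 : R))).
under [X in _ <= _ * X]eq_Rintegral do rewrite mulr1.
rewrite [leRHS]mulrC; apply: Rintegral_Chebyshev_association => //;
  first exact: bounded_a.
by move=> x y; exact: a_nincr.
Qed.

End weighted.

(** The layer-cake formula turns the moment into tails, each tail is bounded by an exponential of
    rate [k * h (Y w)], and Tonelli's theorem returns to a fixed [w], where the tail integral is
    [2 / (k * h) ^+ 2]. A vanishing hazard rate makes the right-hand integrand [+oo]. *)
Lemma integral_gap_sqr_le :
  (\int[P]_w ((Z w - Y w) ^+ 2)%:E <=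
   (2 / k%:R ^+ 2)%:E * \int[P]_w inv_hazard_sq F f (Y w))%E.
Proof.
pose h := hazard_rate F f.
have h0 x : 0 <= h x by exact: hazard_rate_ge0.
have mf : measurable_fun [set: R] f by case: densF.
have mF : measurable_fun [set: R] F.
  by apply: nondecreasing_measurable => // x y;
    exact: (cdf_nondecreasing_density densF).
have mh : measurable_fun [set: R] h.
  apply: measurable_funM => //; apply: measurable_fun_inv => [x|].
    by rewrite subr_ge0.
  exact: measurable_funB.
have mhY : measurable_fun [set: T] (fun w => h (Y w)) by exact: measurableT_comp.
have d2 (x : R) : is_derive x 1 (fun x => x ^+ 2) (2 * x).
  have hd := is_deriveX 2 (is_derive_id x 1).
  by apply: (is_derive_eq hd); rewrite /GRing.scale/=; ring.
have c2 : continuous (fun t : R => 2 * t).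
  exact: mulrl_continuous.
have pos2 (t : R) : 0 <= t -> 0 <= 2 * t by move=> t0; rewrite mulr_ge0.
have -> : (\int[P]_w ((Z w - Y w) ^+ 2)%:E = \int[P]_w (1 * (Z w - Y w) ^+ 2)%:E)%E.
  by apply: eq_integral => w _; rewrite mul1r.
rewrite (layer_cake_expectation d2 c2 (expr0n _ 2) pos2 P (bounded_measurable_cst
  (1 : R)) _ mD)//.
have tail0 (t : R) : 0 <= (0 <= t)%R%:R * (2 * t).
  by case: (leP 0 t) => [t0|]; [rewrite mul1r pos2|rewrite mul0r].
pose H (q : T * measurableTypeR R) : \bar R :=
  ((0 <= q.2)%R%:R * (2 * q.2) * expR (- (k%:R * h (Y q.1) * q.2)))%:E.
have mb0 : measurable_fun [set: measurableTypeR R] (fun t : R => (0 <=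
  t)%R%:R * (2 * t)).
  apply: measurable_funM; last exact: continuous_measurable_fun.
  have : measurable_fun [set: measurableTypeR R] (fun t : R => 0 <=
    t) by exact: measurable_fun_ler.
  by move=> mb; case: (@bounded_measurable_bool R _ _ _ mb).
have mH : measurable_fun [set: T * measurableTypeR R] H.
  apply/measurable_EFinP; apply: measurable_funM.
    exact: (measurableT_comp mb0 (@measurable_snd _ _ T (measurableTypeR R))).
  apply: measurableT_comp => //; apply: measurableT_comp => //.
  apply: measurable_funM; last exact: (@measurable_snd _ _ T (measurableTypeR R)).
  apply: measurable_funM => //.
  exact: (measurableT_comp mhY (@measurable_fst _ _ T (measurableTypeR R))).
have H0 q : (0 <= H q)%E by rewrite lee_fin mulr_ge0// expR_ge0.
apply: (@le_trans _ _ (\int[mu]_t \int[P]_w H (w, t))%E).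
  apply: ge0_le_integral => //.
  - move=> t _; rewrite lee_fin mulr_ge0//; apply: Rintegral_ge0 => w _.
    by rewrite mulr1.
  - have := @measurable_tail (fun x => x) (fun t => 2 * t) 1 c2.
    by under eq_fun do rewrite mul1r.
  - exact: (@measurable_fun_fubini_tonelli_G _ _ T (measurableTypeR R) R P H mH H0).
  move=> t _; rewrite /H /=.
  have [t0|t0] := leP 0 t; last first.
    by rewrite !mul0r; apply: integral_ge0 => w _; rewrite lee_fin !mul0r.
  under [leRHS]eq_integral do rewrite mul1r EFinM.
  have bexp : bounded_measurable (fun w => expR (- (k%:R * h (Y w) * t))).
    apply: (@bounded_measurable_range _ _ _ 0 1).
      apply: measurableT_comp => //; apply: measurableT_comp => //.
      by apply: measurable_funM => //; exact: measurable_funM.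
    move=> w; rewrite expR_ge0/= -expR0 ler_expR oppr_le0.
    by rewrite mulr_ge0// mulr_ge0.
  rewrite ge0_integralZl//; last 2 first.
  - by apply/measurable_EFinP; case: bexp.
  - by rewrite lee_fin pos2.
  rewrite -EFin_Rintegral// -EFinM lee_fin mul1r ler_wpM2l ?pos2//.
  rewrite (gap_conditional indepX cdfX densF k_gt0 k_lt_n t0
    (bounded_measurable_cst (1 : R))).
  apply: le_Rintegral_bounded => //.
    under eq_fun do rewrite mulr1.
    exact: (bounded_measurable_comp mY (bounded_a t0)).
  by move=> w; rewrite mulr1; exact: a_le_exp.
rewrite -(@fubini_tonelli _ _ T (measurableTypeR R) R P mu H mH H0).
have minv : measurable_fun [set: T] (fun w => inv_hazard_sq F f (Y w)).
  rewrite (_ : (fun w => _) =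
    fun w => if h (Y w) == 0 then +oo%E else ((h (Y w))^-1 ^+ 2)%:E).
    apply: measurable_fun_ifT => //; first exact: measurable_fun_eqr.
    apply/measurable_EFinP; apply: measurable_funX.
    exact: measurable_fun_inv.
  apply/funext => w; rewrite /inv_hazard_sq inver -/h.
  by case: eqP => _; rewrite ?expe2 ?mulyy// -expe2 EFin_expe.
have inv0 w : (0 <= inv_hazard_sq F f (Y w))%E.
  have i0 : (0 <= (h (Y w))%:E^-1)%E.
    by rewrite inve_ge0 lee_fin.
  by rewrite /inv_hazard_sq expe2 mule_ge0.
have c0 : (0 <= (2 / k%:R ^+ 2 : R)%:E)%E by rewrite lee_fin divr_ge0// sqr_ge0.
rewrite -ge0_integralZl//.
apply: ge0_le_integral => //.
- by move=> w _; apply: integral_ge0.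
- exact: (@measurable_fun_fubini_tonelli_F _ _ T (measurableTypeR R) R mu H mH H0).
- exact: measurable_funeM.
move=> w _; rewrite /inv_hazard_sq inver -/(h _).
have k0 : 0 < k%:R :> R by rewrite ltr0n.
case: eqP => [hY0|/eqP hY0].
  by rewrite expe2 mulyy gt0_muley ?leey// lte_fin divr_gt0// exprn_gt0.
have hY : 0 < h (Y w) by rewrite lt_neqAle eq_sym hY0 h0.
rewrite /H /= integral_exponential_second_moment ?(mulr_gt0 k0 hY)//.
rewrite ?expe2 -!EFinM lee_fin le_eqVlt; apply/orP; left; apply/eqP.
by field; rewrite !gt_eqF.
Qed.

End gap_moments.

(** * Variance and exponential moment bounds *)

Section consequences.
Context {R : realType} {d : measure_display} {T : measurableType d}.
Context {P : probability T R} {n : nat}.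
Variables (X : 'I_n -> {RV P >-> R}) (F f : R -> R).
Hypothesis indepX : mutually_independent X.
Hypothesis cdfX : forall (i : 'I_n) (x : R), cdf (X i) x = (F x)%:E.
Hypothesis densF : is_density_of f F.
Hypothesis h_nondecr : nondecreasing_hazard_rate F f.
Variable k : nat.
Hypotheses (k_gt0 : (0 < k)%N) (k_lt_n : (k < n)%N).
Local Notation Z := (order_stat (fun i => X i : T -> R) k).
Local Notation Y := (order_stat (fun i => X i : T -> R) k.+1).

Let mZ : measurable_fun [set: T] Z.
Proof. by apply: measurable_order_stat; rewrite k_gt0 ltnW. Qed.
Let mY : measurable_fun [set: T] Y.
Proof. exact: measurable_order_stat. Qed.
Let mD : measurable_fun [set: T] (fun w => Z w - Y w).
Proof. exact: measurable_funB. Qed.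
Let D_ge0 w : 0 <= Z w - Y w.
Proof. by rewrite subr_ge0; exact: order_stat_le. Qed.

Let bounded_clip m (U : T -> R) : 0 <= m -> measurable_fun [set: T] U ->
  bounded_measurable (fun w => clip m (U w)).
Proof.
move=> m0 mU; apply: (@bounded_measurable_range _ _ _ (- m) m).
  by apply: measurableT_comp => //; exact: measurable_clip.
by move=> w; exact: clip_range.
Qed.

(** Clipping is a contraction, so the clipped gaps are dominated by the true gap uniformly in [m];
    the variance then passes to the limit on the left. *)
Lemma variance_le_gap (U : T -> R) (c : R) : 0 <= c -> U \in Lfun P 2%:E ->
  (forall m, 0 <= m -> \int[P]_w clip m (U w) ^+ 2 - (\int[P]_w clip m (U w)) ^+ 2
    <=
    c * \int[P]_w (clip m (Z w) - clip m (Y w)) ^+ 2) ->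
  ('V_P[U] <= c%:E * \int[P]_w ((Z w - Y w) ^+ 2)%:E)%E.
Proof.
move=> c0 U2 h.
have PT : P [set: T] \is a fin_num by rewrite probability_setT.
have U1 : U \in Lfun P 1 := Lfun_subset12 PT U2.
have intU : P.-integrable [set: T] (EFin \o U) by apply/Lfun1_integrable.
have mU : measurable_fun [set: T] U by apply/measurable_EFinP;
  case/integrableP: intU.
rewrite /variance !unlock.
apply: (centered_limit (Psi := fun x => x ^+ 2) intU) => [|x|m].
- by move=> x; exact: exprn_continuous.
- exact: sqr_ge0.
have m0 : 0 <= m%:R :> R by [].
have bU := bounded_clip m0 mU.
have bU2 := bounded_measurableM bU bU.
have bc x : bounded_measurable (fun _ : T => x : R) by exact:
  bounded_measurable_cst.
set e := \int[P]_v clip m%:R (U v).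
have bUe : bounded_measurable (fun w => (clip m%:R (U w) - e) ^+ 2).
  by apply: bounded_measurableM; exact: bounded_measurableB bU (bc e).
rewrite -EFin_Rintegral//.
have -> : \int[P]_w (clip m%:R (U w) - e) ^+ 2 =
    \int[P]_w clip m%:R (U w) ^+ 2 - e ^+ 2.
  have -> : \int[P]_w (clip m%:R (U w) - e) ^+ 2 =
      \int[P]_w (clip m%:R (U w) * clip m%:R (U w) - 2 * e * clip m%:R (U w) + e
        ^+ 2).
    by apply: eq_Rintegral => w _; ring.
  have i1 := bounded_measurable_integrable P bU2.
  have i2 := bounded_measurable_integrable P (bounded_measurableZ (2 * e) bU).
  have i3 := bounded_measurable_integrable P (bounded_measurableB bU2
    (bounded_measurableZ (2 * e) bU)).
  rewrite RintegralD//; last exact: bounded_measurable_integrable.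
  rewrite RintegralB// RintegralZl//; last exact: bounded_measurable_integrable.
  by rewrite Rintegral_probability_cst -/e; ring.
have bZY : bounded_measurable (fun w => (clip m%:R (Z w) - clip m%:R (Y w)) ^+ 2).
  have bd := bounded_measurableB (bounded_clip m0 mZ) (bounded_clip m0 mY).
  exact: (bounded_measurableM bd bd).
apply: (@le_trans _ _ (c * \int[P]_w (clip m%:R (Z w) - clip m%:R (Y w)) ^+ 2)%:E).
  by rewrite lee_fin; exact: h.
rewrite EFinM EFin_Rintegral// lee_wpmul2l ?lee_fin//.
apply: ge0_le_integral => //.
- by move=> w _; rewrite lee_fin sqr_ge0.
- by apply/measurable_EFinP; case: bZY.
- by apply/measurable_EFinP; exact: measurable_funX.
move=> w _; rewrite lee_fin.
have := @clip_lipschitz R m%:R _ _ (order_stat_le X k_gt0 k_lt_n w).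
by move=> /andP[a b]; rewrite lerXn2r ?nnegrE.
Qed.

Lemma variance_upper : Z \in Lfun P 2%:E ->
  ('V_P[Z] <= k%:R%:E * \int[P]_w ((Z w - Y w) ^+ 2)%:E)%E.
Proof. by move=> Z2; apply: variance_le_gap => // m m0;
  exact: efron_stein_upper. Qed.

Lemma variance_lower : Y \in Lfun P 2%:E ->
  ('V_P[Y] <= (n - k)%:R%:E * \int[P]_w ((Z w - Y w) ^+ 2)%:E)%E.
Proof. by move=> Y2; apply: variance_le_gap => // m m0;
  exact: efron_stein_lower. Qed.

Section exponential_moment.
Variable lambda : R.
Hypothesis lambda_gt0 : 0 < lambda.
Hypothesis intZ : P.-integrable [set: T] (EFin \o Z).
Local Notation D := (fun w => Z w - Y w).
Hypothesis intD : P.-integrable [set: T]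
  (EFin \o (fun w => D w * (expR (lambda * D w) - 1))).

Let x w := lambda * D w.
Let x_ge0 w : 0 <= x w. Proof. by rewrite mulr_ge0// ltW. Qed.
Let mx : measurable_fun [set: T] x. Proof. exact: measurable_funM. Qed.
(** [q] and [2 * r] are the coefficients of [t ^+ 2] and [t ^+ 3] in [psi_scale]. The half in [r]
    anticipates the integration of [t] over [0, 1], after which [q + r] is compared with [b]. *)
Let q w := x w ^+ 2 / 2.
Let r w := (psi (x w) - x w ^+ 2 / 2) / 2.
Let b w := lambda / 2 * (D w * (expR (lambda * D w) - 1)).

Let q_ge0 w : 0 <= q w. Proof. by rewrite divr_ge0// sqr_ge0. Qed.
Let r_ge0 w : 0 <= r w.
Proof. by rewrite divr_ge0// subr_ge0 psi_ge_quadratic. Qed.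
Let qr_le w : q w + r w <= b w.
Proof. by apply: le_trans (psi_half_le (x_ge0 w)) _; rewrite /b /x; lra. Qed.

Let mpsi : measurable_fun [set: R] (@psi R).
Proof. exact: (continuous_measurable_fun continuous_psi). Qed.

Let intb : P.-integrable [set: T] (EFin \o b).
Proof. exact: (integrableZl measurableT _ intD). Qed.

Let mq : measurable_fun [set: T] q.
Proof. by apply: measurable_funM => //; exact: measurable_funX. Qed.

Let intq : P.-integrable [set: T] (EFin \o q).
Proof.
apply: (le_integrable _ _ _ intb) => //; first exact/measurable_EFinP.
move=> w _; rewrite lee_fin !ger0_norm//.
  by have := qr_le w; have := r_ge0 w; lra.
by apply: le_trans (qr_le w); rewrite addr_ge0.
Qed.

Let intr : P.-integrable [set: T] (EFin \o r).
Proof.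
apply: (le_integrable _ _ _ intb) => //.
  apply/measurable_EFinP; apply: measurable_funM => //;
    apply: measurable_funB => //.
  exact: measurableT_comp.
move=> w _; rewrite lee_fin !ger0_norm//.
  by have := qr_le w; have := q_ge0 w; lra.
by apply: le_trans (qr_le w); rewrite addr_ge0.
Qed.

Let Iq := \int[P]_w q w.
Let Ir := \int[P]_w r w.

Let psi_moment_le t : 0 <= t <= 1 ->
  (\int[P]_w (psi (t * lambda * D w))%:E <= (t ^+ 2 * Iq + t ^+ 3 * (2 * Ir))%:E)%E.
Proof.
move=> t01.
have i1 : P.-integrable [set: T] (EFin \o (fun w => t ^+ 2 * q w)).
  exact: (integrableZl measurableT _ intq).
have i2 : P.-integrable [set: T] (EFin \o (fun w => t ^+ 3 * 2 * r w)).
  exact: (integrableZl measurableT _ intr).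
have i12 : P.-integrable [set: T] (EFin \o (fun w => t ^+ 2 * q w + t ^+ 3 * 2 * r
  w)).
  exact: (integrableD measurableT i1 i2).
apply: (@le_trans _ _ (\int[P]_w (t ^+ 2 * q w + t ^+ 3 * 2 * r w)%:E)%E).
  apply: ge0_le_integral => //.
  - by move=> w _; rewrite lee_fin psi_ge0.
  - by apply/measurable_EFinP; apply: (measurableT_comp mpsi);
    exact: measurable_funM.
  - exact: measurable_int i12.
  move=> w _; rewrite lee_fin -mulrA; apply: le_trans (psi_scale t01 (x_ge0 w)) _.
  by rewrite /q /r le_eqVlt; apply/orP; left; apply/eqP; field.
rewrite -[leLHS]fineK; last exact: integrable_fin_num i12.
rewrite -[fine _]/(\int[P]_w (t ^+ 2 * q w + t ^+ 3 * 2 * r w)).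
by rewrite RintegralD// !RintegralZl// mulrA.
Qed.

Section clipped.
Variable m : R.
Hypothesis m_ge0 : 0 <= m.

Let bcZ : bounded_measurable (fun w => clip m (Z w)).
Proof. exact: bounded_clip. Qed.
Let bcY : bounded_measurable (fun w => clip m (Y w)).
Proof. exact: bounded_clip. Qed.

Let phi u (y : R) := expR (u * Num.min y m).

(** Lowering the second argument from [clip m (Y w)] to the minimum of [Y w] and [m] can only
    increase the divergence, and the new difference is at most the true gap. If [Z w < - m], both
    clipped values are [- m] and the divergence vanishes. *)
Let bregman_clip_le u w : 0 <= u ->
  expR (u * clip m (Y w)) * psi (u * clip m (Z w) - u * clip m (Y w)) <=
  phi u (Y w) * psi (u * D w).
Proof.
move=> u0; have YZ := order_stat_le X k_gt0 k_lt_n w.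
have cYZ : clip m (Y w) <= clip m (Z w) by exact: clip_le.
have mc : Num.min (Y w) m <= clip m (Y w) by rewrite /clip le_max lexx orbT.
have [mZw|Zm] := leP (- m) (Z w); last first.
  have -> : clip m (Z w) = - m.
    rewrite /clip (min_idPl _) ?(max_idPl _)//; first exact: ltW.
    by apply: le_trans (ltW Zm) _; rewrite ge0_cp.
  have -> : clip m (Y w) = - m.
    rewrite /clip (min_idPl _) ?(max_idPl _)//; first exact: le_trans YZ (ltW Zm).
    by apply: le_trans YZ _; apply: le_trans (ltW Zm) _; rewrite ge0_cp.
  rewrite subrr {1}/psi sub0r expR0 mulr1 subrr mulr0.
  by rewrite mulr_ge0 ?expR_ge0 ?psi_ge0.
apply: (le_trans (expR_psi_nincr (ler_wpM2l u0 mc) (ler_wpM2l u0 cYZ))).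
rewrite ler_wpM2l ?expR_ge0// -mulrBr; apply: psi_ndecr.
  by rewrite mulr_ge0// subr_ge0 (le_trans mc).
rewrite ler_wpM2l// clip_le_min//.
by case: (leP (Z w) m); case: (leP (Y w) m); lra.
Qed.

Let bphi u : 0 <= u -> bounded_measurable (phi u).
Proof.
move=> u0; apply: (@bounded_measurable_range _ _ _ 0 (expR (u * m))).
  by apply: measurableT_comp => //; apply: measurable_funM => //;
    exact: measurable_minr.
by move=> y; rewrite expR_ge0 ler_expR ler_wpM2l// ge_min lexx orbT.
Qed.

Let entropy_clip_le t : 0 < t <= 1 ->
  \int[P]_w (expR (t * (lambda * clip m (Z w))) * (t * (lambda * clip m (Z w)))) -
    (\int[P]_w expR (t * (lambda * clip m (Z w)))) *
      ln (\int[P]_w expR (t * (lambda * clip m (Z w)))) <=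
  (t ^+ 2 * (k%:R * Iq) + t ^+ 3 * (k%:R * (2 * Ir))) *
    \int[P]_w expR (t * (lambda * clip m (Z w))).
Proof.
move=> /andP[t0 t1]; pose u := t * lambda.
have u0 : 0 <= u by rewrite mulr_ge0// ltW.
have -> : \int[P]_w (expR (t * (lambda * clip m (Z w))) * (t * (lambda * clip m (Z
  w)))) =
    \int[P]_w (expR (u * clip m (Z w)) * (u * clip m (Z w))).
  by apply: eq_Rintegral => w _; rewrite /u !mulrA.
have -> : \int[P]_w expR (t * (lambda * clip m (Z w))) =
  \int[P]_w expR (u * clip m (Z w)).
  by apply: eq_Rintegral => w _; rewrite /u !mulrA.
apply: (le_trans (entropy_upper indepX k_gt0 k_lt_n m_ge0 u0)).
have bY := bounded_measurableZ u bcY.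
have bZ := bounded_measurableZ u bcZ.
have bdiff := bounded_measurableB bZ bY.
have bbreg : bounded_measurable (fun w =>
    expR (u * clip m (Y w)) * psi (u * clip m (Z w) - u * clip m (Y w))).
  apply: bounded_measurableM; first exact: bounded_measurable_expR.
  apply: bounded_measurableD; first exact: bounded_measurable_cst.
  apply: bounded_measurableM; last exact: bounded_measurable_expR.
  by apply: bounded_measurableB => //; exact: bounded_measurable_cst.
have bexp := bounded_measurable_expR bZ.
have -> : (t ^+ 2 * (k%:R * Iq) + t ^+ 3 * (k%:R * (2 * Ir))) * \int[P]_w expR (u
  * clip m (Z w)) =
    k%:R * (\int[P]_w expR (u * clip m (Z w)) * (t ^+ 2 * Iq + t ^+ 3 * (2 * Ir)))
      by ring.
rewrite ler_wpM2l// -lee_fin EFin_Rintegral//.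
apply: (@le_trans _ _ (\int[P]_w (phi u (Y w) * psi (u * D w))%:E)%E).
  apply: ge0_le_integral => //.
  - by move=> w _; rewrite lee_fin mulr_ge0 ?expR_ge0 ?psi_ge0.
  - by apply/measurable_EFinP; case: bbreg.
  - apply/measurable_EFinP; apply: measurable_funM.
      by case: (bounded_measurable_comp mY (bphi u0)).
    by apply: (measurableT_comp mpsi); exact: measurable_funM.
  by move=> w _; rewrite lee_fin; exact: bregman_clip_le.
have cu : continuous (fun y : R => u * (u * y * expR (u * y))).
  have ce : continuous (fun y : R => expR (u * y)).
    by move=> y; apply: continuous_comp;
      [exact: mulrl_continuous|exact: continuous_expR].
  move=> y; apply: cvgM; first exact: cvg_cst.
  by apply: cvgM; [exact: mulrl_continuous|exact: ce].
have psi0 : psi (u * 0) = 0 by rewrite mulr0 /psi sub0r expR0 mulr1 subrr.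
have pos (y : R) : 0 <= y -> 0 <= u * (u * y * expR (u * y)).
  by move=> y0; rewrite mulr_ge0// mulr_ge0 ?expR_ge0// mulr_ge0.
have phile a c : a <= c -> phi u a <= phi u c.
  move=> ac; rewrite ler_expR ler_wpM2l//.
  by case: (leP a m); case: (leP c m); lra.
apply: (le_trans (integral_gap_association indepX cdfX densF h_nondecr k_gt0 k_lt_n
  (is_derive_psiM u) cu psi0 pos (bphi u0) (fun y => expR_ge0 _) phile)).
have t01 : 0 <= t <= 1 by rewrite (ltW t0).
have Ephi0 : 0 <= \int[P]_w phi u (Y w) by apply: Rintegral_ge0 => w _;
  exact: expR_ge0.
apply: (le_trans (lee_wpmul2l _ (psi_moment_le t01))); first by rewrite lee_fin.
rewrite -EFinM lee_fin ler_wpM2r//.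
  have Iq0 : 0 <= Iq by exact: Rintegral_ge0.
  have Ir0 : 0 <= Ir by exact: Rintegral_ge0.
  by rewrite addr_ge0// mulr_ge0 ?exprn_ge0 ?(ltW t0)// mulr_ge0.
(* The weight in [Y] is enlarged to the Laplace transform of the clipped [Z], which closes the
   differential inequality. *)
apply: le_Rintegral_bounded => //.
  exact: (bounded_measurable_comp mY (bphi u0)).
move=> w; rewrite ler_expR ler_wpM2l//.
apply: (@le_trans _ _ (clip m (Y w))); first by rewrite /clip le_max lexx orbT.
by apply: clip_le; exact: order_stat_le.
Qed.

Lemma log_laplace_clip_le :
  ln (\int[P]_w expR (lambda * clip m (Z w))) <=
  \int[P]_w (lambda * clip m (Z w)) + k%:R * \int[P]_w b w.
Proof.
have bV := bounded_measurableZ lambda bcZ.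
have Iq0 : 0 <= Iq by exact: Rintegral_ge0.
have Ir0 : 0 <= Ir by exact: Rintegral_ge0.
have a0 : 0 <= k%:R * Iq by rewrite mulr_ge0.
have b0 : 0 <= k%:R * (2 * Ir) by rewrite !mulr_ge0.
apply: (le_trans (herbst bV a0 b0 entropy_clip_le)).
rewrite -addrA lerD2l.
(* The half produced by Herbst's argument cancels the [2] in front of [Ir]. *)
have -> : k%:R * Iq + k%:R * (2 * Ir) / 2 = k%:R * (Iq + Ir) by field.
rewrite ler_wpM2l// -RintegralD//; apply: le_Rintegral => //.
exact: (integrableD measurableT intq intr).
Qed.

End clipped.

Lemma centered_mgf_le :
  (\int[P]_w (expR (lambda * (Z w - fine (\int[P]_v (Z v)%:E))))%:E <=
   (expR (k%:R * \int[P]_w b w))%:E)%E.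
Proof.
apply: (centered_limit (Psi := fun y => expR (lambda * y)) intZ) => [|y|m].
- move=> y; apply: continuous_comp;
  [exact: mulrl_continuous|exact: continuous_expR].
- exact: expR_ge0.
have m0 : 0 <= m%:R :> R by [].
have bV := bounded_measurableZ lambda (bounded_clip m0 mZ).
have bE := bounded_measurable_expR bV.
set e := \int[P]_v _.
have bEe : bounded_measurable (fun w => expR (lambda * (clip m%:R (Z w) - e))).
  apply: bounded_measurable_expR; apply: bounded_measurableZ.
  by apply: bounded_measurableB;
    [exact: bounded_clip|exact: bounded_measurable_cst].
rewrite -EFin_Rintegral// lee_fin.
have -> : \int[P]_w expR (lambda * (clip m%:R (Z w) - e)) =
    \int[P]_w (expR (- (lambda * e)) * expR (lambda * clip m%:R (Z w))).
  by apply: eq_Rintegral => w _; rewrite -expRD; congr expR; ring.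
rewrite RintegralZl//; last exact: bounded_measurable_integrable.
have := log_laplace_clip_le m0.
rewrite RintegralZl//; last exact/bounded_measurable_integrable/bounded_clip.
rewrite -/e => h.
have M0 : 0 < \int[P]_w expR (lambda * clip m%:R (Z w)).
  apply: (@lt_le_trans _ _ (expR (- (lambda * m%:R)))); first exact: expR_gt0.
  rewrite -[leLHS](Rintegral_probability_cst P); apply: le_Rintegral_bounded => //.
    exact: bounded_measurable_cst.
  move=> w; rewrite ler_expR -mulrN ler_wpM2l ?(ltW lambda_gt0)//.
  by have /andP[] := clip_range (Z w) m0.
by rewrite -[X in _ * X <= _]lnK ?posrE// -expRD ler_expR; lra.
Qed.

End exponential_moment.

End consequences.

Theorem theorem2p9 (R : realType) (d : measure_display) (T : measurableType d)
    (P : probability T R) (n : nat) (X : 'I_n -> {RV P >-> R}) (F f : R -> R)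
    (n_ge2 : (2 <= n)%N)
    (indepX : mutually_independent X)
    (cdfX : forall (i : 'I_n) (x : R), cdf (X i) x = (F x)%:E)
    (densF : is_density_of f F)
    (h_nondecr : nondecreasing_hazard_rate F f) :
  [/\ (forall k : nat, (1 <= k)%N -> (2 * k <= n)%N ->
        order_stat X k \in Lfun P 2%:E ->
        ('V_P[order_stat X k] <= 'E_P[Vstat X k])%E /\
        ('E_P[Vstat X k] <= (2 / k%:R)%:E *
           \int[P]_w inv_hazard_sq F f (order_stat X k.+1 w))%E),
      (forall k : nat, (n < 2 * k)%N -> (k <= n)%N ->
        order_stat X k \in Lfun P 2%:E ->
        ('V_P[order_stat X k] <=
           (2 * (n - k + 1)%:R / (k - 1)%:R ^+ 2)%:E *
           \int[P]_w inv_hazard_sq F f (order_stat X k w))%E)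
    & (forall (lambda : R) (k : nat), 0 <= lambda ->
        (1 <= k)%N -> (2 * k <= n)%N ->
        order_stat X k \in Lfun P 1%E ->
        (lne 'E_P[(fun w => expR (lambda *
                  (order_stat X k w - fine 'E_P[order_stat X k]%E)))%R] <=
           (lambda * (k%:R / 2))%:E *
           'E_P[(fun w => spacing X k w *
                  (expR (lambda * spacing X k w) - 1))%R])%E /\
        ((lambda * (k%:R / 2))%:E *
           'E_P[(fun w => spacing X k w *
                  (expR (lambda * spacing X k w) - 1))%R] =
         (lambda * (k%:R / 2))%:E *
           'E_P[(fun w => Num.sqrt (Vstat X k w / k%:R) *
                  (expR (lambda * Num.sqrt (Vstat X k w / k%:R)) - 1))%R])%E)].
Proof.
pose Z k := order_stat (fun i => X i : T -> R) k.
have mZ k : (0 < k <= n)%N -> measurable_fun [set: T] (Z k).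
  exact: measurable_order_stat.
have gap0 k w : (0 < k)%N -> (k < n)%N -> 0 <= Z k w - Z k.+1 w.
  by move=> k0 kn; rewrite subr_ge0; exact: order_stat_le.
have mgap k : (0 < k)%N -> (k < n)%N ->
  measurable_fun [set: T] (fun w => Z k w - Z k.+1 w).
  by move=> k0 kn; apply: measurable_funB; apply: mZ; rewrite ?k0 ?kn// ltnW.
have EV k : (0 < k)%N -> (k < n)%N -> ('E_P[Vstat X k] =
    k%:R%:E * \int[P]_w ((Z k w - Z k.+1 w) ^+ 2)%:E)%E.
  move=> k0 kn; rewrite unlock -ge0_integralZl//.
  - by apply/measurable_EFinP; apply: measurable_funX; exact: mgap.
  - by move=> w _; rewrite lee_fin sqr_ge0.
split.
- move=> k k0 kn; have {}kn : (k < n)%N by lia.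
  move=> Z2; rewrite EV//; split; first exact: variance_upper.
  have k1 : 0 < k%:R :> R by rewrite ltr0n.
  apply: (@le_trans _ _ (k%:R%:E * ((2 / k%:R ^+ 2)%:E * \int[P]_w inv_hazard_sq F
    f (Z k.+1 w)))%E).
    by rewrite lee_wpmul2l ?lee_fin//; exact: integral_gap_sqr_le.
  rewrite muleA -EFinM; have -> : k%:R * (2 / k%:R ^+ 2) = 2 / k%:R :> R by field;
    rewrite gt_eqF.
  exact: lexx.
(* The rank is written [k.+1]: the variance of X_(k+1) is bounded by the gap just above it, while
   the hazard rate is evaluated at X_(k+1) itself. *)
- move=> [|k] nk kn; first by lia.
  have k0 : (0 < k)%N by lia.
  move=> Z2; have -> : (n - k.+1 + 1 = n - k)%N by lia.
  have -> : (k.+1 - 1 = k)%N by lia.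
  apply: (le_trans (variance_lower indepX k0 kn Z2)).
  apply: (@le_trans _ _ ((n - k)%:R%:E * ((2 / k%:R ^+ 2)%:E * \int[P]_w
    inv_hazard_sq F f (Z k.+1 w)))%E).
    by rewrite lee_wpmul2l ?lee_fin//; exact: integral_gap_sqr_le.
  rewrite muleA -EFinM; have ->
    : (n - k)%:R * (2 / k%:R ^+ 2) = 2 * (n - k)%:R / k%:R ^+ 2 :> R by ring.
  exact: lexx.
move=> lambda k lambda0 k0 kn; have {}kn : (k < n)%N by lia.
move=> /Lfun1_integrable intZ.
have k1 : 0 < k%:R :> R by rewrite ltr0n.
split; last first.
  congr (_ * _)%E; congr expectation; apply/funext => w.
  have -> : Num.sqrt (Vstat X k w / k%:R) = spacing X k w; last by [].
  by rewrite /Vstat mulrAC divff ?gt_eqF// mul1r sqrtr_sqr ger0_norm//; exact: gap0.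
(* For [lambda = 0] both sides are [0], the factor [0] annihilating the expectation. *)
move: lambda0; rewrite le_eqVlt => /predU1P[<-|lambda0].
  rewrite mul0r mul0e unlock.
  under eq_integral do rewrite mul0r expR0.
  have -> : (\int[P]__ 1 = 1 :> \bar R)%E.
    by rewrite integral_cst// mul1e; exact: probability_setT.
  by rewrite lne1.
have mg := mgap k k0 kn.
pose A w := (Z k w - Z k.+1 w) * (expR (lambda * (Z k w - Z k.+1 w)) - 1).
have A0 w : 0 <= A w.
  by rewrite mulr_ge0 ?gap0// subr_ge0 -expR0 ler_expR mulr_ge0 ?gap0// ltW.
have mA : measurable_fun [set: T] A.
  apply: measurable_funM => //; apply: measurable_funB => //.
  by apply: measurableT_comp => //; exact: measurable_funM.
have c0 : 0 < lambda * (k%:R / 2) by rewrite mulr_gt0// divr_gt0.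
have -> : 'E_P[(fun w => spacing X k w * (expR (lambda * spacing X k w) - 1))%R]%E =
    (\int[P]_w (A w)%:E)%E by rewrite unlock.
(* An infinite expectation makes the bound trivial; a finite one supplies the integrability on which
   Herbst's argument relies. *)
have [Afin|] := ltP (\int[P]_w (A w)%:E)%E +oo%E; last first.
  by rewrite leye_eq => /eqP ->; rewrite gt0_muley ?lte_fin// leey.
have intA : P.-integrable [set: T] (EFin \o A).
  apply/integrableP; split; first exact/measurable_EFinP.
  by under eq_integral do rewrite /= ger0_norm//.
have := centered_mgf_le indepX cdfX densF h_nondecr k0 kn lambda0 intZ intA.
rewrite RintegralZl// => h.
have -> : ((lambda * (k%:R / 2))%:E * \int[P]_w (A w)%:E =
    (k%:R * (lambda / 2 * \int[P]_w A w))%:E)%E.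
  rewrite -[X in (_ * X)%E]fineK; last exact: integrable_fin_num intA.
  by rewrite -EFinM; congr EFin; rewrite /Rintegral; field.
rewrite !unlock.
set m := (\int[P]_w _)%E in h *.
have m0 : (0 <= m)%E by apply: integral_ge0 => w _; rewrite lee_fin expR_ge0.
by rewrite -lee_expeR lneK ?in_itv/= ?m0 ?leey.
Qed.
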